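(* Let $(\mathcal X,\mathcal Y)$ be a balanced pair in an abelian category $\mathcal A$. (1) If $\mathcal X\text{-}\operatorname{res.dim}\mathcal Y<\infty$ and $\mathcal Y\text{-}\operatorname{cores.dim}\mathcal X<\infty$, then $D_{\mathbb R\mathcal X\text{-}sg}(\mathcal A)=D_{\mathbb L\mathcal Y\text{-}sg}(\mathcal A)$. (2) If $(\mathcal X,\mathcal Y)$ is admissible and $\mathcal X\text{-}\operatorname{res.dim}\mathcal A<\infty$, then $D_{\mathbb R\mathcal X\text{-}sg}(\mathcal A)=0=D_{\mathbb L\mathcal Y\text{-}sg}(\mathcal A)$.
   Context: $\mathcal A$ is an abelian category; a subcategory of $\mathcal A$ means a full additive subcategory closed under isomorphisms and direct summands. A morphism $f:X\to M$ with $X\in\mathcal X$ is a right $\mathcal X$-approximation of $M$ if every morphism $X'\to M$ with $X'\in\mathcal X$ factors through $f$; $\mathcal X$ is contravariantly finite in $\mathcal A$ if every object of $\mathcal A$ has a right $\mathcal X$-approximation. Left approximations and covariantly finite subcategories are defined dually. A complex $A^\bullet$ in $\mathcal A$ is right $\mathcal X$-acyclic if $\operatorname{Hom}_{\mathcal A}(X,A^\bullet)$ is acyclic for all $X\in\mathcal X$, and left $\mathcal X$-acyclic if $\operatorname{Hom}_{\mathcal A}(A^\bullet,X)$ is acyclic for all $X\in\mathcal X$. For $\mathcal X$ contravariantly finite, an $\mathcal X$-resolution of $M$ is a right $\mathcal X$-acyclic complex $\cdots\to X^{-1}\to X^0\to M\to 0$ with all $X^i\in\mathcal X$; $\mathcal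 X\text{-}\operatorname{res.dim}M$ is the minimal $n\ge0$ such that there is an $\mathcal X$-resolution $0\to X^{-n}\to\cdots\to X^0\to M\to0$ ($\infty$ if none exists). For $\mathcal Y$ covariantly finite, a $\mathcal Y$-coresolution of $N$ is a left $\mathcal Y$-acyclic complex $0\to N\to Y^0\to Y^1\to\cdots$ with all $Y^i\in\mathcal Y$; $\mathcal Y\text{-}\operatorname{cores.dim}N$ is defined dually. Put $\mathcal X\text{-}\operatorname{res.dim}\mathcal A:=\sup\{\mathcal X\text{-}\operatorname{res.dim}M\mid M\in\mathcal A\}$, $\mathcal X\text{-}\operatorname{res.dim}\mathcal Y:=\sup\{\mathcal X\text{-}\operatorname{res.dim}Y\mid Y\in\mathcal Y\}$ and $\mathcal Y\text{-}\operatorname{cores.dim}\mathcal X:=\sup\{\mathcal Y\text{-}\operatorname{cores.dim}X\mid X\in\mathcal X\}$. A pair $(\mathcal X,\mathcal Y)$ of subcategories is a balanced pair if $\mathcal X$ is contravariantly finite, $\mathcal Y$ is covariantly finite, every $M\in\mathcal A$ has an $\mathcal X$-resolution that is left $\mathcal Y$-acyclic, and every $N\in\mathcal A$ has a $\mathcal Y$-coresolution that is right $\mathcal X$-acyclic. In that case a complex is right $\mathcal X$-acyclic if and only if it is left $\mathcal Y$-acyclic; such complexes are called $\ast$-acyclic. The balanced pair is admissible if every right $\mathcal X$-approximation is an epimorphism (equivalently, every left $\mathcal Y$-approximation is a monomorphism). $D^b_\ast(\mathcal A)$ is the Verdier quotient of the bounded homotopy category $K^b(\mathcal A)$ by the thick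 subcategory of $\ast$-acyclic complexes. The canonical functors $K^b(\mathcal X)\to D^b_\ast(\mathcal A)$ and $K^b(\mathcal Y)\to D^b_\ast(\mathcal A)$ are fully faithful, and $K^b(\mathcal X)$, $K^b(\mathcal Y)$ are regarded as full triangulated subcategories of $D^b_\ast(\mathcal A)$ (up to isomorphism in $D^b_\ast(\mathcal A)$). The right $\mathcal X$-singularity category is the Verdier quotient $D_{\mathbb R\mathcal X\text{-}sg}(\mathcal A):=D^b_\ast(\mathcal A)/K^b(\mathcal X)$ and the left $\mathcal Y$-singularity category is $D_{\mathbb L\mathcal Y\text{-}sg}(\mathcal A):=D^b_\ast(\mathcal A)/K^b(\mathcal Y)$. *)

(* Defs.v *)
From Stdlib Require Import RelationClasses.
From mathcomp Require Import all_boot all_order all_algebra.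
From mathcomp Require Import boolp.

Set Implicit Arguments.
Unset Strict Implicit.
Unset Printing Implicit Defensive.

Import Order.TTheory GRing.Theory Num.Theory.
Local Open Scope ring_scope.

(** * Abelian categories *)

Record PreaddCat := {
  Ob :> Type;
  Hom : Ob -> Ob -> zmodType;
  idm : forall X, Hom X X;
  compm : forall X Y Z, Hom Y Z -> Hom X Y -> Hom X Z;
  compmA : forall X Y Z T (h : Hom Z T) (g : Hom Y Z) (f : Hom X Y),
    compm h (compm g f) = compm (compm h g) f;
  comp1m : forall X Y (f : Hom X Y), compm (idm Y) f = f;
  compm1 : forall X Y (f : Hom X Y), compm f (idm X) = f;
  compmDl : forall X Y Z (g g' : Hom Y Z) (f : Hom X Y),
    compm (g + g') f = compm g f + compm g' f;
  compmDr : forall X Y Z (g : Hom Y Z) (f f' : Hom X Y),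
    compm g (f + f') = compm g f + compm g f'
}.

Arguments idm {p} X.
Arguments compm {p X Y Z} g f.

Notation "g \c f" := (compm g f) (at level 40, left associativity).

Section PreadditiveNotions.
Variable A : PreaddCat.
Implicit Types X Y Z : A.

Definition is_zero_ob Z : Prop :=
  forall X, (forall u v : Hom X Z, u = v) /\ (forall u v : Hom Z X, u = v).

Definition is_biproduct X Y S (i1 : Hom X S) (i2 : Hom Y S)
    (p1 : Hom S X) (p2 : Hom S Y) : Prop :=
  [/\ p1 \c i1 = idm X, p2 \c i2 = idm Y, p1 \c i2 = 0, p2 \c i1 = 0
    & i1 \c p1 + i2 \c p2 = idm S].

Definition direct_sum X Y S : Prop :=
  exists (i1 : Hom X S) (i2 : Hom Y S) (p1 : Hom S X) (p2 : Hom S Y),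
    is_biproduct i1 i2 p1 p2.

Definition iso_ob X Y : Prop :=
  exists (u : Hom X Y) (v : Hom Y X), v \c u = idm X /\ u \c v = idm Y.

Definition is_mono X Y (f : Hom X Y) : Prop :=
  forall T (u v : Hom T X), f \c u = f \c v -> u = v.

Definition is_epi X Y (f : Hom X Y) : Prop :=
  forall T (u v : Hom Y T), u \c f = v \c f -> u = v.

Definition is_kernel X Y (f : Hom X Y) K (k : Hom K X) : Prop :=
  f \c k = 0 /\
  forall T (t : Hom T X), f \c t = 0 -> exists! u : Hom T K, k \c u = t.

Definition is_cokernel X Y (f : Hom X Y) Q (q : Hom Y Q) : Prop :=
  q \c f = 0 /\
  forall T (t : Hom Y T), t \c f = 0 -> exists! u : Hom Q T, u \c q = t.

End PreadditiveNotions.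

Record AbCat := {
  ab_preadd :> PreaddCat;
  ab_zero : exists Z : ab_preadd, is_zero_ob Z;
  ab_sum : forall X Y : ab_preadd, exists S, direct_sum X Y S;
  ab_ker : forall (X Y : ab_preadd) (f : Hom X Y),
    exists K (k : Hom K X), is_kernel f k;
  ab_coker : forall (X Y : ab_preadd) (f : Hom X Y),
    exists Q (q : Hom Y Q), is_cokernel f q;
  ab_mono : forall (X Y : ab_preadd) (f : Hom X Y), is_mono f ->
    exists Z (g : Hom Y Z), is_kernel g f;
  ab_epi : forall (X Y : ab_preadd) (f : Hom X Y), is_epi f ->
    exists W (g : Hom W X), is_cokernel g f
}.

Record Subcat (A : AbCat) := {
  in_sub :> A -> Prop;
  sub_zero : forall Z, is_zero_ob Z -> in_sub Z;
  sub_sum : forall X Y S, direct_sum X Y S -> in_sub X -> in_sub Y -> in_sub S;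
  sub_iso : forall X Y, iso_ob X Y -> in_sub X -> in_sub Y;
  sub_summand : forall X Y S, direct_sum X Y S -> in_sub S -> in_sub X
}.

(** * Complexes and the relative notions *)

(* Cohomological grading, indexed by int.  The differential leaves degree n
   for degree n + 1; stating every condition at degrees n, n + 1, n + 1 + 1
   keeps shifts, cones and homotopies free of casts.                        *)
Record Complex (A : PreaddCat) := {
  cob :> int -> A;
  diff : forall n : int, Hom (cob n) (cob (n + 1));
  diff2 : forall n, diff (n + 1) \c diff n = 0
}.

Arguments diff {A} c n.

Section Relative.
Variables (A : AbCat) (X Y : Subcat A).
Implicit Types (C : Complex A) (M N : A).

Definition right_approx M X0 (f : Hom X0 M) : Prop :=
  X X0 /\ forall X1 (g : Hom X1 M), X X1 -> exists h : Hom X1 X0, f \c h = g.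

Definition left_approx N Y0 (f : Hom N Y0) : Prop :=
  Y Y0 /\ forall Y1 (g : Hom N Y1), Y Y1 -> exists h : Hom Y0 Y1, h \c f = g.

Definition contravariantly_finite : Prop :=
  forall M, exists X0 (f : Hom X0 M), right_approx f.

Definition covariantly_finite : Prop :=
  forall N, exists Y0 (f : Hom N Y0), left_approx f.

Definition right_acyclic C : Prop :=
  forall X0, X X0 -> forall n (u : Hom X0 (C (n + 1))),
    diff C (n + 1) \c u = 0 -> exists v : Hom X0 (C n), diff C n \c v = u.

Definition left_acyclic C : Prop :=
  forall Y0, Y Y0 -> forall n (u : Hom (C (n + 1)) Y0),
    u \c diff C n = 0 ->
    exists v : Hom (C (n + 1 + 1)) Y0, v \c diff C (n + 1) = u.

(* X^{-i} sits in degree -i and M, up to isomorphism, in degree 1. *)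
Definition is_resolution M C : Prop :=
  [/\ iso_ob (C 1) M,
      forall i : int, i <= 0 -> X (C i),
      forall i : int, 1 < i -> is_zero_ob (C i)
    & right_acyclic C].

(* Y^i sits in degree i and N, up to isomorphism, in degree -1. *)
Definition is_coresolution N C : Prop :=
  [/\ iso_ob (C (-1)) N,
      forall i : int, 0 <= i -> Y (C i),
      forall i : int, i < -1 -> is_zero_ob (C i)
    & left_acyclic C].

Definition has_resolution_of_length M (n : nat) : Prop :=
  exists C, is_resolution M C /\
    forall i : int, i < - n%:Z -> is_zero_ob (C i).

Definition has_coresolution_of_length N (n : nat) : Prop :=
  exists C, is_coresolution N C /\
    forall i : int, n%:Z < i -> is_zero_ob (C i).

(* The least natural number satisfying P, with None standing for infinity. *)
Definition least (P : nat -> Prop) : option nat :=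
  match pselect (exists n, `[< P n >]) with
  | left exP => Some (ex_minn exP)
  | right _ => None
  end.

Definition resdim M : option nat := least (has_resolution_of_length M).

Definition coresdim N : option nat := least (has_coresolution_of_length N).

(* sup { dim M | S M } < infinity: the extended naturals dim M have a common
   finite upper bound.                                                       *)
Definition sup_finite (dim : A -> option nat) (S : A -> Prop) : Prop :=
  exists N : nat, forall M, S M -> exists2 n, dim M = Some n & (n <= N)%N.

Record balanced_pair : Prop := {
  bp_contra : contravariantly_finite;
  bp_cov : covariantly_finite;
  bp_res : forall M, exists C, is_resolution M C /\ left_acyclic C;
  bp_cores : forall N, exists C, is_coresolution N C /\ right_acyclic C
}.

Definition admissible : Prop :=
  forall M X0 (f : Hom X0 M), right_approx f -> is_epi f.

(* For a balanced pair the two conditions are equivalent. *)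
Definition star_acyclic C : Prop := right_acyclic C /\ left_acyclic C.

End Relative.

(** * Categories with hom-setoids, and their localizations *)

(* Equality of morphisms is an equivalence relation: homotopy for K^b(A), and
   the congruence generated by the defining relations for a localization.    *)
Record Category := {
  Obj :> Type;
  Mor : Obj -> Obj -> Type;
  Meq : forall X Y, Mor X Y -> Mor X Y -> Prop;
  idc : forall X, Mor X X;
  compc : forall X Y Z, Mor Y Z -> Mor X Y -> Mor X Z;
  Meq_equiv : forall X Y, Equivalence (@Meq X Y);
  compc_proper : forall X Y Z (g g' : Mor Y Z) (f f' : Mor X Y),
    Meq g g' -> Meq f f' -> Meq (compc g f) (compc g' f');
  compcA : forall X Y Z T (h : Mor Z T) (g : Mor Y Z) (f : Mor X Y),
    Meq (compc h (compc g f)) (compc (compc h g) f);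
  comp1c : forall X Y (f : Mor X Y), Meq (compc (idc Y) f) f;
  compc1 : forall X Y (f : Mor X Y), Meq (compc f (idc X)) f
}.

Arguments Mor {c} X Y.
Arguments Meq {c X Y} f g.
Arguments idc {c} X.
Arguments compc {c X Y Z} g f.

Notation "g \C f" := (compc g f) (at level 40, left associativity).
Notation "f =c g" := (Meq f g) (at level 70, no associativity).

Lemma Meq_refl (C : Category) (X Y : C) (f : Mor X Y) : f =c f.
Proof. by case: (Meq_equiv X Y). Qed.

Lemma Meq_sym (C : Category) (X Y : C) (f g : Mor X Y) : f =c g -> g =c f.
Proof. by case: (Meq_equiv X Y) => _ s _; apply: s. Qed.

Lemma Meq_trans (C : Category) (X Y : C) (f g h : Mor X Y) :
  f =c g -> g =c h -> f =c h.
Proof. by case: (Meq_equiv X Y) => _ _; apply. Qed.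

Record Functor (C D : Category) := {
  fob :> C -> D;
  fmap : forall X Y : C, Mor X Y -> Mor (fob X) (fob Y);
  fmap_proper : forall (X Y : C) (f g : Mor X Y), f =c g -> fmap f =c fmap g;
  fmap1 : forall X : C, fmap (idc X) =c idc (fob X);
  fmap_comp : forall (X Y Z : C) (g : Mor Y Z) (f : Mor X Y),
    fmap (g \C f) =c fmap g \C fmap f
}.

Arguments fmap {C D} _ {X Y} _.

Section CategoryNotions.
Variable C : Category.

Definition inverse_pair (X Y : C) (u : Mor X Y) (v : Mor Y X) : Prop :=
  v \C u =c idc X /\ u \C v =c idc Y.

Definition iso (X Y : C) : Prop :=
  exists (u : Mor X Y) (v : Mor Y X), inverse_pair u v.

(* Equivalent to the terminal category. *)
Definition is_zero_cat : Prop :=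
  inhabited C /\
  forall X Y : C, exists f : Mor X Y, forall g : Mor X Y, g =c f.

End CategoryNotions.

(* Morphisms of the localization C[W^-1]: formal composites of morphisms of C
   and inverses of elements of W, modulo the least congruence making C -> C[W^-1]
   a functor and inverting W (Gabriel-Zisman).                               *)
Section Localization.
Variables (C : Category) (W : forall X Y : C, Mor X Y -> Prop).

Inductive locmor : C -> C -> Type :=
| loc_in X Y (f : Mor X Y) : locmor X Y
| loc_inv X Y (s : Mor X Y) (Ws : W s) : locmor Y X
| loc_comp X Y Z (v : locmor Y Z) (u : locmor X Y) : locmor X Z.

Inductive loceq : forall X Y, locmor X Y -> locmor X Y -> Prop :=
| loceq_refl X Y (u : locmor X Y) : loceq u u
| loceq_sym X Y (u v : locmor X Y) : loceq u v -> loceq v u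
| loceq_trans X Y (u v w : locmor X Y) : loceq u v -> loceq v w -> loceq u w
| loceq_comp X Y Z (v v' : locmor Y Z) (u u' : locmor X Y) :
    loceq v v' -> loceq u u' -> loceq (loc_comp v u) (loc_comp v' u')
| loceq_assoc X Y Z T (w : locmor Z T) (v : locmor Y Z) (u : locmor X Y) :
    loceq (loc_comp w (loc_comp v u)) (loc_comp (loc_comp w v) u)
| loceq_1l X Y (u : locmor X Y) : loceq (loc_comp (loc_in (idc Y)) u) u
| loceq_1r X Y (u : locmor X Y) : loceq (loc_comp u (loc_in (idc X))) u
| loceq_in X Y (f g : Mor X Y) : f =c g -> loceq (loc_in f) (loc_in g)
| loceq_in_comp X Y Z (g : Mor Y Z) (f : Mor X Y) :
    loceq (loc_in (g \C f)) (loc_comp (loc_in g) (loc_in f))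
| loceq_invl X Y (s : Mor X Y) (Ws : W s) :
    loceq (loc_comp (loc_inv Ws) (loc_in s)) (loc_in (idc X))
| loceq_invr X Y (s : Mor X Y) (Ws : W s) :
    loceq (loc_comp (loc_in s) (loc_inv Ws)) (loc_in (idc Y)).

Lemma loceq_equiv X Y : Equivalence (@loceq X Y).
Proof.
split; [exact: loceq_refl | exact: loceq_sym | exact: loceq_trans].
Qed.

Definition Loc : Category := {|
  Obj := C;
  Mor := locmor;
  Meq := loceq;
  idc := fun X => loc_in (idc X);
  compc := loc_comp;
  Meq_equiv := loceq_equiv;
  compc_proper := loceq_comp;
  compcA := loceq_assoc;
  comp1c := loceq_1l;
  compc1 := loceq_1r |}.

Definition Loc_functor : Functor C Loc := {|
  fob := fun X : C => (X : Loc);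
  fmap := fun X Y (f : @Mor C X Y) => loc_in f : @Mor Loc X Y;
  fmap_proper := loceq_in;
  fmap1 := fun X => loceq_refl (loc_in (idc X));
  fmap_comp := loceq_in_comp |}.

Variables (S : Functor C C)
  (WS : forall (X Y : C) (s : Mor X Y), W s -> W (fmap S s)).

Fixpoint locmap X Y (u : locmor X Y) : locmor (S X) (S Y) :=
  match u in locmor X Y return locmor (S X) (S Y) with
  | loc_in _ _ f => loc_in (fmap S f)
  | loc_inv _ _ _ Ws => loc_inv (WS Ws)
  | loc_comp _ _ _ v u => loc_comp (locmap v) (locmap u)
  end.

Lemma locmap_proper X Y (u v : locmor X Y) :
  loceq u v -> loceq (locmap u) (locmap v).
Proof.
elim=> {X Y u v} /=.
- by move=> *; apply: loceq_refl.
- by move=> *; apply: loceq_sym.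
- by move=> X Y u v w _ uv _ vw; apply: loceq_trans uv vw.
- by move=> *; apply: loceq_comp.
- by move=> *; apply: loceq_assoc.
- move=> X Y u; apply: loceq_trans (loceq_1l _).
  by apply: loceq_comp (loceq_refl _); apply/loceq_in/fmap1.
- move=> X Y u; apply: loceq_trans (loceq_1r _).
  by apply: loceq_comp (loceq_refl _) _; apply/loceq_in/fmap1.
- by move=> *; apply/loceq_in/fmap_proper.
- move=> X Y Z g f; apply: loceq_trans (loceq_in_comp _ _).
  by apply/loceq_in/fmap_comp.
- by move=> X Y s Ws; apply: loceq_trans (loceq_invl _) _;
     apply/loceq_sym/loceq_in/fmap1.
- by move=> X Y s Ws; apply: loceq_trans (loceq_invr _) _;
     apply/loceq_sym/loceq_in/fmap1.
Qed.

Definition Loc_endo : Functor Loc Loc := {|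
  fob := (S : Loc -> Loc);
  fmap := fun X Y (u : @Mor Loc X Y) => locmap u : @Mor Loc (S X) (S Y);
  fmap_proper := locmap_proper;
  fmap1 := fun X => loceq_in (fmap1 S X);
  fmap_comp := fun X Y Z g f => loceq_refl _ |}.

End Localization.

(** * Triangles and Verdier quotients *)

Section Triangles.
Variables (C : Category) (S : Functor C C).

Definition triangles : Type :=
  forall X Y Z : C, Mor X Y -> Mor Y Z -> Mor Z (S X) -> Prop.

Definition iso_closure (B : triangles) : triangles := fun X Y Z f g h =>
  exists (X' Y' Z' : C) (f' : Mor X' Y') (g' : Mor Y' Z') (h' : Mor Z' (S X'))
    (a : Mor X X') (a1 : Mor X' X) (b : Mor Y Y') (b1 : Mor Y' Y)
    (c : Mor Z Z') (c1 : Mor Z' Z),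
  B X' Y' Z' f' g' h' /\
  [/\ inverse_pair a a1, inverse_pair b b1 & inverse_pair c c1] /\
  [/\ b \C f =c f' \C a, c \C g =c g' \C b & fmap S a \C h =c h' \C c].

(* The translate of a triangle is a triangle up to the signs of g and h, which
   cannot be named in a bare category.                                        *)
Definition translation_stable (B : triangles) : Prop :=
  forall X Y Z f g h, B X Y Z f g h ->
  exists g' h', B (S X) (S Y) (S Z) (fmap S f) g' h'.

Lemma fmap_inverse_pair (X Y : C) (u : Mor X Y) (v : Mor Y X) :
  inverse_pair u v -> inverse_pair (fmap S u) (fmap S v).
Proof.
case=> vu uv; split.
- apply: Meq_trans (Meq_sym (fmap_comp _ _ _)) _.
  exact: Meq_trans (fmap_proper _ vu) (fmap1 _ _).
- apply: Meq_trans (Meq_sym (fmap_comp _ _ _)) _.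
  exact: Meq_trans (fmap_proper _ uv) (fmap1 _ _).
Qed.

Lemma inverse_pairKl (X Y Z : C) (u : Mor Y Z) (v : Mor Z Y) (f : Mor X Z) :
  inverse_pair u v -> u \C (v \C f) =c f.
Proof.
case=> _ uv; apply: Meq_trans (compcA _ _ _) _.
exact: Meq_trans (compc_proper uv (Meq_refl f)) (comp1c f).
Qed.

Lemma iso_closure_stable (B : triangles) :
  translation_stable B -> translation_stable (iso_closure B).
Proof.
move=> SB X Y Z f g h.
case=> [X' [Y' [Z' [f' [g' [h' [a [a1 [b [b1 [c [c1]]]]]]]]]]]].
move=> [BT [[ia ib ic] [bf _ _]]].
have [g2 [h2 BS]] := SB _ _ _ _ _ _ BT.
exists (fmap S c1 \C (g2 \C fmap S b)).
exists (fmap S (fmap S a1) \C (h2 \C fmap S c)).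
exists (S X'), (S Y'), (S Z'), (fmap S f'), g2, h2.
exists (fmap S a), (fmap S a1), (fmap S b), (fmap S b1), (fmap S c), (fmap S c1).
split=> //; split; first by split; apply: fmap_inverse_pair.
split.
- apply: Meq_trans (Meq_sym (fmap_comp _ _ _)) _.
  exact: Meq_trans (fmap_proper _ bf) (fmap_comp _ _ _).
- exact: inverse_pairKl (fmap_inverse_pair ic).
- exact: inverse_pairKl (fmap_inverse_pair (fmap_inverse_pair ia)).
Qed.

End Triangles.

(* A category with a translation functor and a class of distinguished triangles,
   i.e. the data of a triangulated category.  Verdier's axioms are properties of
   the instances used below and play no part in forming Verdier quotients; only
   the stability of triangles under translation is needed, to let the
   translation descend.                                                       *)
Record TriCat := {
  tri_cat :> Category;
  transl : Functor tri_cat tri_cat;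
  dist : triangles transl;
  dist_stable : translation_stable dist
}.

Arguments dist {t X Y Z} f g h.
Arguments transl {t}.

Record StableClass (T : TriCat) := {
  in_class :> T -> Prop;
  class_transl : forall Z, in_class Z -> in_class (transl Z)
}.

(* A category with triangles equipped with a functor from T. *)
Record TriUnder (T : TriCat) := {
  under_cat :> TriCat;
  under_functor : Functor T under_cat
}.

Section VerdierQuotient.
Variables (T : TriCat) (K : StableClass T).

Definition cone_in X Y (s : @Mor T X Y) : Prop :=
  exists Z (g : Mor Y Z) (h : Mor Z (transl X)), dist s g h /\ K Z.

Lemma cone_in_transl X Y (s : @Mor T X Y) :
  cone_in s -> cone_in (fmap transl s).
Proof.
case=> Z [g [h [dT KZ]]]; have [g' [h' dT']] := dist_stable dT.
by exists (transl Z), g', h'; split=> //; apply: class_transl.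
Qed.

Definition Vcat : Category := Loc cone_in.
Definition Vfunctor : Functor T Vcat := Loc_functor cone_in.
Definition Vtransl : Functor Vcat Vcat := Loc_endo cone_in_transl.

Definition Vimage : triangles Vtransl := fun X Y Z f g h =>
  exists f0 g0 h0, @dist T X Y Z f0 g0 h0 /\
    [/\ f =c fmap Vfunctor f0, g =c fmap Vfunctor g0 & h =c fmap Vfunctor h0].

Lemma Vimage_stable : translation_stable Vimage.
Proof.
move=> X Y Z f g h [f0 [g0 [h0 [dT [ff _ _]]]]].
have [g' [h' dT']] := dist_stable dT.
exists (fmap Vfunctor g'), (fmap Vfunctor h'), (fmap transl f0), g', h'.
split=> //; split; try exact: Meq_refl.
exact: (fmap_proper Vtransl ff).
Qed.

Definition Verdier_quotient : TriUnder T := {|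
  under_cat := {| tri_cat := Vcat;
                  transl := Vtransl;
                  dist := iso_closure Vimage;
                  dist_stable := iso_closure_stable Vimage_stable |};
  under_functor := Vfunctor |}.

End VerdierQuotient.

(** * The bounded homotopy category *)

Section PreaddLemmas.
Variable A : PreaddCat.

Lemma compm0 (X Y Z : A) (g : Hom Y Z) : g \c (0 : Hom X Y) = 0.
Proof. by apply: (addrI (g \c 0)); rewrite -compmDr !addr0. Qed.

Lemma comp0m (X Y Z : A) (f : Hom X Y) : (0 : Hom Y Z) \c f = 0.
Proof. by apply: (addrI (0 \c f)); rewrite -compmDl !addr0. Qed.

Lemma compmN (X Y Z : A) (g : Hom Y Z) (f : Hom X Y) : g \c (- f) = - (g \c f).
Proof. by apply: (addrI (g \c f)); rewrite -compmDr !subrr compm0. Qed.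

Lemma compNm (X Y Z : A) (g : Hom Y Z) (f : Hom X Y) : (- g) \c f = - (g \c f).
Proof. by apply: (addrI (g \c f)); rewrite -compmDl !subrr comp0m. Qed.

End PreaddLemmas.

Section Homotopy.
Variable A : PreaddCat.
Implicit Types C D E : Complex A.

Record ChainMap C D := {
  chain :> forall n : int, Hom (C n) (D n);
  chainP : forall n : int, diff D n \c chain n = chain (n + 1) \c diff C n
}.

Definition homotopic C D (f g : ChainMap C D) : Prop :=
  exists h : forall n : int, Hom (C (n + 1)) (D n),
  forall n : int, f (n + 1) - g (n + 1) =
    diff D n \c h n + h (n + 1) \c diff C (n + 1).

Lemma homotopic_equiv C D : Equivalence (@homotopic C D).
Proof.
split.
- move=> f; exists (fun=> 0) => n.
  by rewrite subrr compm0 comp0m addr0.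
- move=> f g [h fg]; exists (fun n => - h n) => n.
  by rewrite compmN compNm -opprD -fg opprB.
- move=> f g k [h fg] [h' gk]; exists (fun n => h n + h' n) => n.
  by rewrite compmDr compmDl addrACA -fg -gk addrA subrK.
Qed.

Definition chain_id C : ChainMap C C.
Proof. by exists (fun n => idm (C n)) => n; rewrite compm1 comp1m. Defined.

Definition chain_comp C D E (g : ChainMap D E) (f : ChainMap C D) :
  ChainMap C E.
Proof.
exists (fun n => g n \c f n) => n.
by rewrite compmA chainP -compmA chainP compmA.
Defined.

Lemma chain_comp_proper C D E (g g' : ChainMap D E) (f f' : ChainMap C D) :
  homotopic g g' -> homotopic f f' ->
  homotopic (chain_comp g f) (chain_comp g' f').
Proof.
case=> [h gg] [k ff]; exists (fun n => h n \c f (n + 1) + g' n \c k n) => n /=.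
have -> : g (n + 1) \c f (n + 1) - g' (n + 1) \c f' (n + 1) =
  (g (n + 1) - g' (n + 1)) \c f (n + 1)
  + g' (n + 1) \c (f (n + 1) - f' (n + 1)).
  by rewrite compmDl compNm compmDr compmN addrA subrK.
rewrite gg ff !compmDl !compmDr !compmA chainP addrACA; congr (_ + _).
by congr (_ + _); rewrite -!compmA chainP.
Qed.

Lemma chain_eq_homotopic C D (f g : ChainMap C D) :
  (forall n, f n = g n) -> homotopic f g.
Proof.
move=> fg; exists (fun=> 0) => n.
by rewrite fg subrr compm0 comp0m addr0.
Qed.

Definition bounded C : Prop :=
  exists N : nat, forall n : int, (N < `|n|)%N -> is_zero_ob (C n).

Record BComplex := {
  bcomplex :> Complex A;
  bcomplexP : bounded bcomplex
}.

Definition Kb_cat : Category.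
Proof.
refine {| Obj := BComplex;
          Mor := fun C D : BComplex => ChainMap C D;
          Meq := fun (C D : BComplex) f g => homotopic f g;
          idc := fun C : BComplex => chain_id C;
          compc := fun (C D E : BComplex) g f => chain_comp g f |}.
- by move=> C D; apply: homotopic_equiv.
- by move=> C D E g g' f f'; apply: chain_comp_proper.
- by move=> C D E F h g f; apply: chain_eq_homotopic => n; apply: compmA.
- by move=> C D f; apply: chain_eq_homotopic => n; apply: comp1m.
- by move=> C D f; apply: chain_eq_homotopic => n; apply: compm1.
Defined.

Definition shift_complex C : Complex A.
Proof.
exists (fun n => C (n + 1)) (fun n => - diff C (n + 1)) => n.
by rewrite compmN compNm opprK diff2.
Defined.

Lemma shift_bounded C : bounded C -> bounded (shift_complex C).
Proof.
case=> N bC; exists N.+1 => n Nn; apply: bC; rewrite -ltnS (leq_trans Nn) //.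
by rewrite -{1}[n](addrK 1) (leq_trans (leqD_dist _ 0 _)) // addr0 addn1.
Qed.

Definition shift_bcomplex (C : BComplex) : BComplex :=
  {| bcomplexP := shift_bounded (bcomplexP C) |}.

Definition shift_chain C D (f : ChainMap C D) :
  ChainMap (shift_complex C) (shift_complex D).
Proof.
exists (fun n => f (n + 1)) => n /=.
by rewrite compNm compmN chainP.
Defined.

Definition Kb_shift : Functor Kb_cat Kb_cat.
Proof.
refine {| fob := shift_bcomplex : Kb_cat -> Kb_cat;
          fmap := fun (C D : BComplex) f => shift_chain f |}.
- move=> C D f g [h fg]; exists (fun n => - h (n + 1)) => n /=.
  by rewrite !(compmN, compNm) !opprK; apply: fg.
- by move=> C; apply: chain_eq_homotopic.
- by move=> C D E g f; apply: chain_eq_homotopic.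
Defined.

(* The standard triangle X -f-> Y -g-> Z -h-> X[1] on a chain map f: Z is the
   mapping cone, Z^n being a biproduct of X^(n+1) and Y^n, with differential
   (x, y) |-> (- d x, f x + d y); g is the injection and h the projection.    *)
Definition standard_triangle : triangles Kb_shift :=
  fun (X Y Z : BComplex) (f : ChainMap X Y) (g : ChainMap Y Z)
      (h : ChainMap Z (shift_complex X)) =>
  exists (i : forall n : int, Hom (X (n + 1)) (Z n))
         (q : forall n : int, Hom (Z n) (Y n)),
  forall n : int,
    is_biproduct (i n) (g n) (h n) (q n) /\
    diff Z n = - (i (n + 1) \c diff X (n + 1) \c h n)
               + g (n + 1) \c f (n + 1) \c h n
               + g (n + 1) \c diff Y n \c q n.

Lemma standard_triangle_stable : translation_stable standard_triangle.
Proof.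
move=> X Y Z f g h [i [q std]].
exists (shift_chain g).
have hP n : diff (shift_complex (shift_complex X)) n \c (- h (n + 1)) =
            (- h (n + 1 + 1)) \c diff (shift_complex Z) n.
  rewrite /= !(compmN, compNm) !opprK -(chainP h (n + 1)) /=.
  by rewrite compNm.
exists (@Build_ChainMap (shift_complex Z) (shift_complex (shift_complex X))
          (fun n => - h (n + 1)) hP).
exists (fun n => - i (n + 1)), (fun n => q (n + 1)) => n /=.
have [[hi qg hg qi ig] dZ] := std (n + 1).
split.
  by split; rewrite ?(compmN, compNm, opprK) ?hi ?qg ?hg ?qi ?oppr0.
by rewrite dZ !(compmN, compNm) !opprD !opprK.
Qed.

Definition Kb : TriCat := {|
  tri_cat := Kb_cat;
  transl := Kb_shift;
  dist := iso_closure standard_triangle;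
  dist_stable := iso_closure_stable standard_triangle_stable |}.

End Homotopy.

(** * Relative derived and singularity categories *)

Section Singularity.
Variables (A : AbCat) (X Y : Subcat A).

Lemma star_acyclic_shift (C : Kb A) :
  star_acyclic X Y C -> star_acyclic X Y (transl C : BComplex A).
Proof.
case=> rC lC; split=> [X0 XX0|Y0 YY0] n u /=.
- rewrite compNm => /eqP; rewrite oppr_eq0 => /eqP /(rC _ XX0 (n + 1)) [v <-].
  by exists (- v); rewrite compmN compNm opprK.
- rewrite compmN => /eqP; rewrite oppr_eq0 => /eqP /(lC _ YY0 (n + 1)) [v <-].
  by exists (- v); rewrite compmN compNm opprK.
Qed.

Definition star_acyclics : StableClass (Kb A) :=
  {| class_transl := star_acyclic_shift |}.

Definition Db : TriCat := Verdier_quotient star_acyclics.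

(* The objects of D^b_*(A) isomorphic there to a bounded complex over P. *)
Definition Kb_image (P : Subcat A) (Z : Db) : Prop :=
  exists C : BComplex A, (forall n, P (C n)) /\ @iso Db Z C.

Lemma Kb_image_shift (P : Subcat A) (Z : Db) :
  Kb_image P Z -> Kb_image P (transl Z).
Proof.
case=> C [PC [u [v uv]]]; exists (shift_bcomplex C); split=> [n|].
  exact: PC.
by exists (fmap transl u), (fmap transl v); apply: fmap_inverse_pair.
Qed.

Definition Kb_sub (P : Subcat A) : StableClass Db :=
  {| class_transl := @Kb_image_shift P |}.

Definition D_RXsg : TriUnder Db := Verdier_quotient (Kb_sub X).

Definition D_LYsg : TriUnder Db := Verdier_quotient (Kb_sub Y).

End Singularity.

(* Main.v *)
From mathcomp Require Import all_boot all_order all_algebra.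
From mathcomp Require Import boolp zify.
Require Import Defs.

(** The core is a statement on single complexes: if the terms of a bounded
    complex [C] have [X]-resolutions of bounded length, then there is a chain
    map [D -> C] from a bounded complex over [X] that induces isomorphisms on
    the cohomology of [Hom(X0, -)] for every [X0] in [X] (lemma [resolve]).  It
    is proved by lowering the lengths in all degrees at once
    ([resolve_step]): with relative epimorphisms [P n -> C n] from objects of
    [X], the pullbacks [L n] of [P (n + 1) -> C (n + 1)] and
    [P n -> C n -> C (n + 1)] form a complex, the map [L -> C] is degreewise
    relatively surjective with contractible kernel, and since [P n] is in [X]
    the pullback is the sum of [P n] and of the syzygy of [C (n + 1)].

    The mapping cone of [D -> C] is right [X]-acyclic.  In a balanced pair it is
    then left [Y]-acyclic ([right_left_acyclic]): the resolutions provided by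
    the pair show that a relatively exact sequence [0 -> K -> B -> L -> 0] stays
    exact under [Hom(-, Y0)].  So [D] and [C] become isomorphic in
    [D^b_*].  Everything applies to the opposite category, which gives maps
    [C -> D] into complexes over [Y] when the terms of [C] have finite
    [Y]-coresolutions.

    In part (1) it follows that [K^b(X)] and [K^b(Y)] have the same closure under
    isomorphism in [D^b_*], so that the two Verdier quotients invert the same
    morphisms.

    In part (2) every object of [D^b_*] is isomorphic to one of [K^b(X)].  If all
    [X]-resolution dimensions are at most [r], the relative [Ext^(r + 1)]
    vanishes, hence by dimension shifting ([lift_cosyzygy]) a left
    [Y]-approximation of an [r]-th cosyzygy splits: the [Y]-coresolutions stop
    as well, and every object is isomorphic to one of [K^b(Y)].  In the
    quotient by all objects, each map [0 -> Z] is inverted, so the quotient is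
    zero ([zero_quotient]). *)

Set Implicit Arguments.
Unset Strict Implicit.
Unset Printing Implicit Defensive.

Import GRing.Theory.
Local Open Scope ring_scope.

(** * Differentials at arbitrary consecutive degrees *)

Section FlexibleDegrees.
Variable A : PreaddCat.
Implicit Types C D : Complex A.

(** The differential from degree [i] to any degree [j] equal to [i + 1]. *)
Definition dd C (i j : int) (e : i + 1 = j) : Hom (C i) (C j) :=
  match e in _ = j return Hom (C i) (C j) with erefl => diff C i end.

Lemma ddE C n (e : n + 1 = n + 1) : dd C e = diff C n.
Proof. by rewrite (eq_irrelevance e erefl). Qed.

Lemma dd_irr C i j (e e' : i + 1 = j) : dd C e = dd C e'.
Proof. by rewrite (eq_irrelevance e e'). Qed.

Lemma dd2 C i j k (ij : i + 1 = j) (jk : j + 1 = k) : dd C jk \c dd C ij = 0.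
Proof. by case: _ / jk; case: _ / ij; apply: diff2. Qed.

Lemma dd_chain C D (f : ChainMap C D) i j (e : i + 1 = j) :
  dd D e \c f i = f j \c dd C e.
Proof. by case: _ / e; apply: chainP. Qed.

End FlexibleDegrees.

Section FlexibleAcyclicity.
Variables (A : AbCat) (X : Subcat A).
Implicit Types C : Complex A.

(** Exactness of [Hom(X0, C)] at [j], for [X0] in [X] and consecutive degrees
    [i], [j], [k]; void for other triples. *)
Definition exact_at_right C (i j k : int) : Prop :=
  forall X0, X X0 -> forall (ij : i + 1 = j) (jk : j + 1 = k)
    (u : Hom X0 (C j)), dd C jk \c u = 0 -> exists v, dd C ij \c v = u.

(** Exactness of [Hom(C, X0)] at [j]. *)
Definition exact_at_left C (i j k : int) : Prop :=
  forall X0, X X0 -> forall (ij : i + 1 = j) (jk : j + 1 = k)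
    (u : Hom (C j) X0), u \c dd C ij = 0 -> exists v, v \c dd C jk = u.

Lemma right_acyclicE C : right_acyclic X C <-> forall i j k, exact_at_right C i j k.
Proof.
split=> [aC i j k X0 XX0 ij jk|aC X0 XX0 n u du].
  case: _ / jk; case: _ / ij => u; exact: aC.
by have := aC n _ _ X0 XX0 erefl erefl u; apply.
Qed.

Lemma left_acyclicE C : left_acyclic X C <-> forall i j k, exact_at_left C i j k.
Proof.
split=> [aC i j k X0 XX0 ij jk|aC X0 XX0 n u du].
  case: _ / jk; case: _ / ij => u; exact: aC.
by have := aC n _ _ X0 XX0 erefl erefl u; apply.
Qed.

End FlexibleAcyclicity.

(** * The opposite category *)

Section Opposite.

(** Composition is reversed definitionally, so kernels in the opposite category are
    cokernels in [A] by conversion. *)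
Definition op_preadd (A : PreaddCat) : PreaddCat.
Proof.
refine {| Ob := A; Hom := fun X Y : A => Hom Y X; idm := fun X => idm X;
          compm := fun X Y Z g f => f \c g |}.
- by move=> *; rewrite compmA.
- by move=> *; rewrite compm1.
- by move=> *; rewrite comp1m.
- by move=> *; rewrite compmDr.
- by move=> *; rewrite compmDl.
Defined.

Lemma op_direct_sum (A : PreaddCat) (X Y S : A) :
  direct_sum X Y S -> @direct_sum (op_preadd A) X Y S.
Proof.
case=> i1 [i2 [p1 [p2 [a b c d e]]]].
by exists p1, p2, i1, i2; split.
Qed.

Lemma direct_sum_op (A : PreaddCat) (X Y S : A) :
  @direct_sum (op_preadd A) X Y S -> direct_sum X Y S.
Proof.
case=> i1 [i2 [p1 [p2 [a b c d e]]]].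
by exists p1, p2, i1, i2; split.
Qed.

Lemma op_is_zero (A : PreaddCat) (Z : A) :
  is_zero_ob Z -> @is_zero_ob (op_preadd A) Z.
Proof. by move=> Z0 X; have [a b] := Z0 X. Qed.

Lemma is_zero_op (A : PreaddCat) (Z : A) :
  @is_zero_ob (op_preadd A) Z -> is_zero_ob Z.
Proof. by move=> Z0 X; have [a b] := Z0 X. Qed.

Definition op_ab (A : AbCat) : AbCat.
Proof.
refine {| ab_preadd := op_preadd A |}.
- by have [Z Z0] := ab_zero A; exists Z; apply: op_is_zero.
- by move=> X Y; have [S XYS] := ab_sum X Y; exists S; apply: op_direct_sum.
- by move=> X Y f; apply: (@ab_coker A Y X f).
- by move=> X Y f; apply: (@ab_ker A Y X f).
- by move=> X Y f; apply: (@ab_epi A Y X f).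
- by move=> X Y f; apply: (@ab_mono A Y X f).
Defined.

Definition op_sub (A : AbCat) (X : Subcat A) : Subcat (op_ab A).
Proof.
refine {| in_sub := fun M : op_ab A => X M |}.
- by move=> Z /is_zero_op; apply: sub_zero.
- by move=> M N S /direct_sum_op; apply: sub_sum.
- by move=> M N [u [v [vu uv]]]; apply: sub_iso; exists v, u.
- by move=> M N S /direct_sum_op; apply: sub_summand.
Defined.

Lemma opp_succ (i j : int) : i + 1 = j -> - j + 1 = - i.
Proof. by move=> <-; rewrite opprD addrNK. Qed.

(** Degree [n] of the opposite complex is degree [- n] of the given one. *)
Definition op_complex (A : PreaddCat) (C : Complex A) : Complex (op_preadd A).
Proof.
refine (@Build_Complex (op_preadd A) (fun n : int => C (- n))
  (fun n => dd C (opp_succ (erefl (n + 1)))) _) => n.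
exact: (@dd2 A C).
Defined.

(** A complex of the opposite category, read in [A]. *)
Definition unop_complex (A : PreaddCat) (C : Complex (op_preadd A)) : Complex A.
Proof.
refine (@Build_Complex A (fun n : int => C (- n))
  (fun n => dd C (opp_succ (erefl (n + 1)))) _) => n.
exact: (@dd2 _ C).
Defined.

Lemma dd_op (A : PreaddCat) (C : Complex A) i j (e : i + 1 = j) (e' : - j + 1 = - i) :
  dd (op_complex C) e = dd C e'.
Proof. by case: _ / e e' => e'; exact: (@dd_irr A C _ _ _ e'). Qed.

Lemma dd_unop (A : PreaddCat) (C : Complex (op_preadd A)) i j
  (e : i + 1 = j) (e' : - j + 1 = - i) : dd (unop_complex C) e = dd C e'.
Proof. by case: _ / e e' => e'; exact: (@dd_irr _ C _ _ _ e'). Qed.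

Lemma op_right_acyclic (A : AbCat) (X : Subcat A) (C : Complex A) :
  left_acyclic X C -> right_acyclic (op_sub X) (op_complex C).
Proof.
move=> /left_acyclicE aC; apply/right_acyclicE => i j k X0 XX0 ij jk u.
rewrite (dd_op _ _ (opp_succ jk)) (dd_op _ _ (opp_succ ij)).
exact: (aC _ _ _ X0 XX0).
Qed.

Lemma op_left_acyclic (A : AbCat) (X : Subcat A) (C : Complex A) :
  right_acyclic X C -> left_acyclic (op_sub X) (op_complex C).
Proof.
move=> /right_acyclicE aC; apply/left_acyclicE => i j k X0 XX0 ij jk u.
rewrite (dd_op _ _ (opp_succ jk)) (dd_op _ _ (opp_succ ij)).
exact: (aC _ _ _ X0 XX0).
Qed.

Lemma oppr_succ (i j : int) : - i + 1 = - j -> j + 1 = i.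
Proof. by move/opp_succ; rewrite !opprK. Qed.

Lemma right_acyclic_op (A : AbCat) (X : Subcat A) (C : Complex A) :
  left_acyclic (op_sub X) (op_complex C) -> right_acyclic X C.
Proof.
move=> /left_acyclicE aC; apply/right_acyclicE.
have aN i j k : exact_at_right X C (- i) (- j) (- k).
  move=> X0 XX0 ij jk u.
  have := aC _ _ _ X0 XX0 (oppr_succ jk) (oppr_succ ij) u.
  by rewrite (dd_op _ _ jk) (dd_op _ _ ij).
by move=> i j k; rewrite -[i]opprK -[j]opprK -[k]opprK.
Qed.

End Opposite.

(** * Relative exactness in a balanced pair *)

Section Kernels.
Variable A : PreaddCat.

Lemma compmB (X Y Z : A) (g : Hom Y Z) (f f' : Hom X Y) :
  g \c (f - f') = g \c f - g \c f'.
Proof. by rewrite compmDr compmN. Qed.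

Lemma compBm (X Y Z : A) (g g' : Hom Y Z) (f : Hom X Y) :
  (g - g') \c f = g \c f - g' \c f.
Proof. by rewrite compmDl compNm. Qed.

Lemma kernel_comp0 (X Y K : A) (f : Hom X Y) (k : Hom K X) :
  is_kernel f k -> f \c k = 0.
Proof. by case. Qed.

Lemma kernel_lift (X Y K : A) (f : Hom X Y) (k : Hom K X) T (t : Hom T X) :
  is_kernel f k -> f \c t = 0 -> exists u, k \c u = t.
Proof. by case=> _ kP /kP [u [ku _]]; exists u. Qed.

Lemma kernel_mono (X Y K : A) (f : Hom X Y) (k : Hom K X) :
  is_kernel f k -> is_mono k.
Proof.
case=> fk kP T u v kuv; have [|w [_ wP]] := kP T (k \c v).
  by rewrite compmA fk comp0m.
by rewrite -(wP u kuv) -(wP v).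
Qed.

Lemma mono0 (X Y T : A) (f : Hom X Y) (u : Hom T X) :
  is_mono f -> f \c u = 0 -> u = 0.
Proof. by move=> fM fu; apply: fM; rewrite fu compm0. Qed.

Lemma zero_ob_from (Z X : A) (u : Hom Z X) : is_zero_ob Z -> u = 0.
Proof. by move=> Z0; have [_ uv] := Z0 X; apply: uv. Qed.

Lemma zero_ob_to (Z X : A) (u : Hom X Z) : is_zero_ob Z -> u = 0.
Proof. by move=> Z0; have [uv _] := Z0 X; apply: uv. Qed.

Lemma is_zero_obP (Z : A) : idm Z = 0 -> is_zero_ob Z.
Proof.
move=> id0 X; split=> u v.
  by rewrite -(comp1m u) -(comp1m v) id0 !comp0m.
by rewrite -(compm1 u) -(compm1 v) id0 !compm0.
Qed.

End Kernels.

Section Relative.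
Variables (A : AbCat) (X : Subcat A).

(** Every morphism from an object of [X] to [M] lifts along [f]. *)
Definition rel_epi (B M : A) (f : Hom B M) : Prop :=
  forall X0, X X0 -> forall g : Hom X0 M, exists h : Hom X0 B, f \c h = g.

(** No nonzero morphism from an object of [X] is killed by [f]. *)
Definition rel_mono (B M : A) (f : Hom B M) : Prop :=
  forall X0, X X0 -> forall h : Hom X0 B, f \c h = 0 -> h = 0.

End Relative.

Section Balanced.
Variables (A : AbCat) (X Y : Subcat A).
Hypothesis XY : forall M : A, exists C, is_resolution X M C /\ left_acyclic Y C.

(** What the left acyclicity of an [X]-resolution of [M] says at [M], at its term
    [P] of degree [0], and at the kernel of the augmentation [P -> M]. *)
Lemma balanced_approx (M : A) : exists (P : A) (e : Hom P M),
  [/\ X P, rel_epi X e,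
      forall Y0, Y Y0 -> forall u : Hom M Y0, u \c e = 0 -> u = 0,
      forall Y0, Y Y0 -> forall u : Hom P Y0,
        (forall X0, X X0 -> forall z : Hom X0 P, e \c z = 0 -> u \c z = 0) ->
        exists v, v \c e = u
    & forall K (k : Hom K P), is_kernel e k ->
      forall Y0, Y Y0 -> forall u : Hom K Y0, exists v, v \c k = u].
Proof.
have approx (N : A) : exists (P : A) (e : Hom P N),
  [/\ X P, rel_epi X e,
      forall Y0, Y Y0 -> forall u : Hom N Y0, u \c e = 0 -> u = 0,
      forall Y0, Y Y0 -> forall u : Hom P Y0,
        (forall X0, X X0 -> forall z : Hom X0 P, e \c z = 0 -> u \c z = 0) ->
        exists v, v \c e = u
    & exists (P1 : A) (d : Hom P1 P), [/\ X P1, e \c d = 0,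
      forall X0, X X0 -> forall z : Hom X0 P, e \c z = 0 ->
        exists w, d \c w = z
      & forall Y0, Y Y0 -> forall u : Hom P1 Y0,
        (forall X0, X X0 -> forall z : Hom X0 P1, d \c z = 0 -> u \c z = 0) ->
        exists v, v \c d = u]].
  have [C [[[a [b [ba ab]]] XC C0 /right_acyclicE rC] /left_acyclicE lC]] := XY N.
  have e01 : 0 + 1 = 1 :> int by [].
  have e12 : 1 + 1 = 2 :> int by [].
  have e10 : - 1 + 1 = 0 :> int by [].
  have e21 : - 2 + 1 = - 1 :> int by [].
  have C20 : is_zero_ob (C 2) by apply: C0.
  exists (C 0), (a \c dd C e01); split.
  - exact: XC.
  - move=> X0 XX0 g.
    have [|v vP] := rC _ _ _ X0 XX0 e01 e12 (b \c g).
      exact: zero_ob_to.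
    by exists v; rewrite -compmA vP compmA ab comp1m.
  - move=> Y0 YY0 u; rewrite compmA => /(lC _ _ _ Y0 YY0 e01 e12) [v].
    rewrite (zero_ob_from v C20) comp0m => ua.
    by rewrite -(compm1 u) -ab compmA -ua comp0m.
  - move=> Y0 YY0 u uP.
    have [|v vP] := lC _ _ _ Y0 YY0 e10 e01 u.
      by apply: uP; [exact: XC | rewrite -compmA dd2 compm0].
    by exists (v \c b); rewrite -compmA (compmA b) ba comp1m.
  exists (C (- 1)), (dd C e10); split.
  - exact: XC.
  - by rewrite -compmA dd2 compm0.
  - move=> X0 XX0 z /(congr1 (compm b)).
    rewrite compm0 !compmA ba comp1m => /(rC _ _ _ X0 XX0 e10 e01) [w wP].
    by exists w.
  - move=> Y0 YY0 u uP.
    have [|v vP] := lC _ _ _ Y0 YY0 e21 e10 u.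
      by apply: uP; [exact: XC | rewrite dd2].
    by exists v.
have [P [e [XP eE eI eF [P1 [d [XP1 ed dE dF]]]]]] := approx M.
exists P, e; split=> // K k kk Y0 YY0 u.
have [t tP] := kernel_lift kk ed.
have [|w wP] := dF Y0 YY0 (u \c t).
  move=> X0 XX0 z dz; rewrite -compmA (_ : t \c z = 0) ?compm0 //.
  by apply: (mono0 (kernel_mono kk)); rewrite compmA tP.
exists w; apply/eqP; rewrite -subr_eq0; apply/eqP.
have [Q [q [XQ _ qI _ _]]] := approx K.
apply: (qI _ YY0).
have [|z zP] := dE Q XQ (k \c q).
  by rewrite compmA (kernel_comp0 kk) comp0m.
have tz : t \c z = q by apply: (kernel_mono kk); rewrite compmA tP.
by rewrite compBm -compmA -zP compmA wP -compmA tz subrr.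
Qed.

(** A relative epimorphism and its kernel form a short sequence that
    [Hom(-, Y0)] turns into an exact one, for [Y0] in [Y]. *)
Section ShortExact.
Variables (K B L : A) (k : Hom K B) (p : Hom B L).
Hypothesis (kp : is_kernel p k) (pE : rel_epi X p).
Variables (Y0 : A) (YY0 : Y Y0).

Lemma rel_epi_cancel (u : Hom L Y0) : u \c p = 0 -> u = 0.
Proof.
move=> up; have [P [e [XP _ eI _ _]]] := balanced_approx L.
apply: (eI _ YY0); have [s <-] := pE XP e.
by rewrite compmA up comp0m.
Qed.

Lemma rel_epi_desc (u : Hom B Y0) : u \c k = 0 -> exists v, v \c p = u.
Proof.
move=> uk.
have [P [e [XP eE _ eF _]]] := balanced_approx L.
have [s sP] := pE XP e.
have [|v vP] := eF _ YY0 (u \c s).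
  move=> X0 XX0 z ez.
  have [|t tP] := kernel_lift (t := s \c z) kp; first by rewrite compmA sP.
  by rewrite -compmA -tP compmA uk comp0m.
exists v; apply/eqP; rewrite -subr_eq0; apply/eqP.
have [R [r [XR _ rI _ _]]] := balanced_approx B.
apply: (rI _ YY0); have [c cP] := eE _ XR (p \c r).
have [|m mP] := kernel_lift (t := r - s \c c) kp.
  by rewrite compmB compmA sP cP subrr.
have -> : r = k \c m + s \c c by rewrite mP subrK.
rewrite compBm !compmDr !compmA -(compmA v p k) (kernel_comp0 kp) uk.
by rewrite compm0 !comp0m !add0r -(compmA v p s) sP vP subrr.
Qed.

(** The relative [Ext^1] of [L] with values in an object of [Y] vanishes.  The
    extension is built on an approximation [r : R -> B] as [g m + w c], where
    [r = k m + s c] with [s : P -> B] lifting an approximation of [L]. *)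
Lemma rel_epi_extend (g : Hom K Y0) : exists h, h \c k = g.
Proof.
have [P [e [XP eE _ _ eX]]] := balanced_approx L.
have [s sP] := pE XP e.
have [K0 [k0 kk0]] := ab_ker e.
have [|t tP] := kernel_lift (t := s \c k0) kp.
  by rewrite compmA sP (kernel_comp0 kk0).
have [w wP] := eX _ _ kk0 _ YY0 (g \c t).
have [R [r [XR rE _ rF _]]] := balanced_approx B.
have [c cP] := eE _ XR (p \c r).
have [|m mP] := kernel_lift (t := r - s \c c) kp.
  by rewrite compmB compmA sP cP subrr.
have [|h hP] := rF _ YY0 (g \c m + w \c c).
  move=> X0 XX0 z rz.
  have [|y yP] := kernel_lift (t := c \c z) kk0.
    by rewrite compmA cP -compmA rz compm0.
  rewrite compmDl -!compmA -yP (compmA w) wP -compmA -compmDr.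
  rewrite (_ : m \c z + _ = 0) ?compm0 //.
  apply: (mono0 (kernel_mono kp)); rewrite compmDr !compmA mP tP.
  by rewrite compBm rz -!compmA yP subrK.
exists h; apply/eqP; rewrite -subr_eq0; apply/eqP.
have [Q [q [XQ _ qI _ _]]] := balanced_approx K.
apply: (qI _ YY0); have [n nP] := rE _ XQ (k \c q).
have [|y yP] := kernel_lift (t := c \c n) kk0.
  by rewrite compmA cP -compmA nP compmA (kernel_comp0 kp) comp0m.
have mn : m \c n = q - t \c y.
  apply: (kernel_mono kp); rewrite compmB !compmA mP tP compBm nP.
  by rewrite -!compmA yP.
rewrite compBm -compmA -nP compmA hP compmDl -!compmA mn -yP (compmA w) wP.
by rewrite compmB -compmA subrK subrr.
Qed.

End ShortExact.

Lemma right_left_acyclic (C : Complex A) : right_acyclic X C -> left_acyclic Y C.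
Proof.
move=> /right_acyclicE aC; apply/left_acyclicE => i j l Y0 YY0 ij jl u du.
(* The kernels cut the complex into relatively exact sequences. *)
have cut a b c (ab : a + 1 = b) (bc : b + 1 = c) (K : A) (k : Hom K (C b)) :
  is_kernel (dd C bc) k -> exists2 p, k \c p = dd C ab & rel_epi X p.
  move=> kk; have [p pP] := kernel_lift kk (dd2 C ab bc).
  exists p => // X0 XX0 g.
  have [|h hP] := aC _ _ _ X0 XX0 ab bc (k \c g).
    by rewrite compmA (kernel_comp0 kk) comp0m.
  by exists h; apply: (kernel_mono kk); rewrite compmA pP.
have [K1 [k1 kk1]] := ab_ker (dd C jl).
have [K2 [k2 kk2]] := ab_ker (dd C (erefl (l + 1))).
have [K3 [k3 kk3]] := ab_ker (dd C (erefl (l + 1 + 1))).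
have [p1 p1P p1E] := cut _ _ _ ij jl _ _ kk1.
have [p2 p2P p2E] := cut _ _ _ jl (erefl _) _ _ kk2.
have [p3 p3P p3E] := cut _ _ _ (erefl _) (erefl _) _ _ kk3.
have ker a (U V W : A) (f : Hom U V) (g : Hom V W) (h : Hom U W) (x : Hom a U) :
  is_mono g -> g \c f = h -> is_kernel h x -> is_kernel f x.
  move=> gM <- [hx xP]; split; first by apply: (mono0 gM); rewrite compmA.
  by move=> T t ft; apply: xP; rewrite -compmA ft compm0.
have kp2 := ker _ _ _ _ _ _ _ _ (kernel_mono kk2) p2P kk1.
have kp3 := ker _ _ _ _ _ _ _ _ (kernel_mono kk3) p3P kk2.
have uk : u \c k1 = 0.
  by apply: (rel_epi_cancel p1E YY0); rewrite -compmA p1P.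
have [v vP] := rel_epi_desc kp2 p2E YY0 uk.
have [h hP] := rel_epi_extend kp3 p3E YY0 v.
by exists h; rewrite -p2P compmA hP.
Qed.

End Balanced.

Section BalancedPair.
Variables (A : AbCat) (X Y : Subcat A) (XY : balanced_pair X Y).

Lemma op_resolution N C : is_coresolution Y N C ->
  is_resolution (op_sub Y) (N : op_ab A) (op_complex C).
Proof.
case=> [[u [v [vu uv]]] YC C0 aC]; split.
- by exists v, u.
- by move=> i i0; apply: YC; rewrite Num.Theory.oppr_ge0.
- by move=> i i1; apply/op_is_zero/C0; rewrite Num.Theory.ltrN2.
- exact: op_right_acyclic.
Qed.

Lemma op_balanced_res (N : op_ab A) :
  exists C, is_resolution (op_sub Y) N C /\ left_acyclic (op_sub X) C.
Proof.
have [C [rC aC]] := bp_cores XY N; exists (op_complex C).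
by split; [apply: op_resolution | apply: op_left_acyclic].
Qed.

Lemma star_of_right C : right_acyclic X C -> star_acyclic X Y C.
Proof. by move=> aC; split=> //; apply: (right_left_acyclic (bp_res XY)). Qed.

Lemma star_of_left C : left_acyclic Y C -> star_acyclic X Y C.
Proof.
move=> aC; split=> //; apply: right_acyclic_op.
by apply: (right_left_acyclic op_balanced_res); apply: op_right_acyclic.
Qed.

End BalancedPair.

(** * Objects of finite resolution length *)

Section FiniteResolutions.
Variables (A : AbCat) (X : Subcat A).

(** [M] has an [X]-resolution of length at most [r], given by its successive
    kernels.  At length [0] there is an object [P] of [X] with a map [P -> M]
    that [Hom(X0, -)] turns into a bijection for [X0] in [X]; unless
    relative epimorphisms are epimorphisms, [M] itself need not lie in [X]. *)
Fixpoint fin_res (r : nat) (M : A) : Prop :=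
  match r with
  | 0 => exists P (e : Hom P M), [/\ X P, rel_epi X e & rel_mono X e]
  | r.+1 => exists P (e : Hom P M) K (k : Hom K P),
      [/\ X P, rel_epi X e, is_kernel e k & fin_res r K]
  end.

Lemma rel_epi1 (M : A) : rel_epi X (idm M).
Proof. by move=> X0 _ g; exists g; rewrite comp1m. Qed.

Lemma fin_res_trivial r M : (forall X0, X X0 -> forall x : Hom X0 M, x = 0) ->
  fin_res r M.
Proof.
have [Z Z0] := ab_zero A.
elim: r M => [|r IHr] M M0.
  exists Z, 0; split; first exact: sub_zero.
    by move=> X0 XX0 g; exists 0; rewrite compm0 [g]M0.
  by move=> X0 _ h _; apply: zero_ob_to.
exists Z, 0, Z, (idm Z); split; first exact: sub_zero.
- by move=> X0 XX0 g; exists 0; rewrite compm0 [g]M0.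
- split=> [|T t _]; first by rewrite comp0m.
  exists t; split=> [|u _]; first by rewrite comp1m.
  by rewrite (zero_ob_to t Z0) (zero_ob_to u Z0).
- by apply: IHr => X0 _ x; apply: zero_ob_to.
Qed.

Lemma fin_res_zero r M : is_zero_ob M -> fin_res r M.
Proof. by move=> M0; apply: fin_res_trivial => X0 _ x; apply: zero_ob_to. Qed.

Lemma fin_resS r M : fin_res r M -> fin_res r.+1 M.
Proof.
elim: r M => [|r IHr] M.
  case=> P [e [XP eE eM]]; have [K [k kk]] := ab_ker e.
  exists P, e, K, k; split=> //; apply: (fin_res_trivial 0) => X0 XX0 x.
  apply: (mono0 (kernel_mono kk)); apply: eM => //.
  by rewrite compmA (kernel_comp0 kk) comp0m.
by case=> P [e [K [k [XP eE kk rK]]]]; exists P, e, K, k; split=> //; apply: IHr.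
Qed.

Lemma fin_res_le r s M : (r <= s)%N -> fin_res r M -> fin_res s M.
Proof.
by move=> /subnK <-; elim: (s - r)%N => // n IHn rM; apply/fin_resS/IHn.
Qed.

Lemma fin_res_sum r K P S : direct_sum K P S -> fin_res r K -> X P -> fin_res r S.
Proof.
case=> [i1 [i2 [p1 [p2 [pi1 pi2 pi12 pi21 ip]]]]] rK XP.
(* An approximation [Q -> K] extends to [Q + P -> K + P] without changing
   the kernel. *)
have cover (Q : A) (e : Hom Q K) : X Q -> rel_epi X e ->
  exists (T : A) (j1 : Hom Q T) (q1 : Hom T Q) (q2 : Hom T P) (f : Hom T S),
  [/\ X T, rel_epi X f, f \c j1 = i1 \c e,
      (q1 \c j1 = idm Q) /\ q2 \c j1 = 0 
    & forall U (u : Hom U T), f \c u = 0 -> (e \c (q1 \c u) = 0) /\ j1 \c (q1 \c u) = u].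
  move=> XQ eE.
  have [T QPT] := ab_sum Q P.
  have XT : X T by apply: sub_sum QPT XQ XP.
  case: QPT => [j1 [j2 [q1 [q2 [qj1 qj2 qj12 qj21 jq]]]]].
  exists T, j1, q1, q2, (i1 \c e \c q1 + i2 \c q2); split=> //.
  - move=> X0 XX0 g; have [h hP] := eE X0 XX0 (p1 \c g).
    exists (j1 \c h + j2 \c (p2 \c g)).
    rewrite !compmDl !compmDr -!compmA !(compmA q1) !(compmA q2).
    rewrite qj1 qj12 qj21 qj2 !comp0m !comp1m !compm0 addr0 add0r hP.
    by rewrite !compmA -compmDl ip comp1m.
  - by rewrite compmDl -!compmA qj1 qj21 compm0 compm1 addr0.
  - move=> U u; rewrite compmDl => fu.
    have := congr1 (compm p1) fu; have := congr1 (compm p2) fu.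
    rewrite !compm0 !compmDr !compmA pi1 pi2 pi12 pi21 !comp0m !comp1m.
    rewrite addr0 add0r => q2u equ; split=> //.
    by rewrite -[RHS]comp1m -jq compmDl -(compmA j2) q2u compm0 addr0.
case: r rK => [|r].
  case=> Q [e [XQ eE eM]].
  have [T [j1 [q1 [q2 [f [XT fE _ _ fker]]]]]] := cover Q e XQ eE.
  exists T, f; split=> // X0 XX0 h /fker [eh <-].
  by rewrite (eM _ XX0 _ eh) compm0.
case=> Q [e [L [l [XQ eE ll rL]]]].
have [T [j1 [q1 [q2 [f [XT fE fj [qj1 _] fker]]]]]] := cover Q e XQ eE.
exists T, f, L, (j1 \c l); split=> //; split.
  by rewrite compmA fj -compmA (kernel_comp0 ll) compm0.
move=> U u /fker [eu ju]; have [v vP] := kernel_lift ll eu.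
exists v; split=> [|w wP]; first by rewrite -compmA vP.
apply: (kernel_mono ll); rewrite vP -wP.
by rewrite -compmA (compmA q1) qj1 comp1m.
Qed.

(** The length may increase by one: the kernel in the lowest degree of the
    resolution is only seen as zero by [X], and is counted as a further step. *)
Lemma fin_res_of_length n M : has_resolution_of_length X M n -> fin_res n.+1 M.
Proof.
case=> C [[[a [b [ba ab]]] XC C0 /right_acyclicE rC] Cn].
(* The kernel in degree [m - n] is reached in [m] steps. *)
have ker (m : nat) : forall i j (ij : i + 1 = j) (K : A) (k : Hom K (C i)),
  i = m%:Z - n%:Z -> i <= 1 -> is_kernel (dd C ij) k -> fin_res m K.
  elim: m => [|m IHm] i j ij K k im i1 kk.
    apply: fin_res_trivial => X0 XX0 x.
    have [|v vP] := rC (i - 1) _ _ X0 XX0 (subrK _ _) ij (k \c x).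
      by rewrite compmA (kernel_comp0 kk) comp0m.
    apply: (mono0 (kernel_mono kk)); rewrite -vP.
    by rewrite (zero_ob_to v) ?compm0 //; apply: Cn; lia.
  have [K' [k' kk']] := ab_ker (dd C (subrK 1 i)).
  have [p pP] := kernel_lift kk (dd2 C (subrK 1 i) ij).
  exists (C (i - 1)), p, K', k'; split.
  - by apply: XC; lia.
  - move=> X0 XX0 g; have [|h hP] := rC _ _ _ X0 XX0 (subrK 1 i) ij (k \c g).
      by rewrite compmA (kernel_comp0 kk) comp0m.
    by exists h; apply: (kernel_mono kk); rewrite compmA pP.
  - split=> [|T t pt].
      by apply: (mono0 (kernel_mono kk)); rewrite compmA pP (kernel_comp0 kk').
    by case: kk' => _; apply; rewrite -pP -compmA pt compm0.
  - by apply: (IHm _ _ (subrK 1 i)) kk'; lia.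
apply: (ker n.+1 1 (1 + 1) erefl M b) => //; first by lia.
split; first by apply: zero_ob_to; apply: C0.
move=> T t _; exists (a \c t); split=> [|u <-]; first by rewrite compmA ba comp1m.
by rewrite compmA ab comp1m.
Qed.

Lemma fin_res_of_resdim (S : A -> Prop) : sup_finite (resdim X) S ->
  exists r, forall M, S M -> fin_res r M.
Proof.
case=> N SN; exists N.+1 => M /SN [n]; rewrite /resdim /least.
case: pselect => // exP [<-]; case: ex_minnP => m /asboolP Mm _ mN.
by apply: fin_res_le (fin_res_of_length Mm).
Qed.

(** The steps can be taken trivial at a zero object, which keeps complexes bounded. *)
Lemma fin_res0_normal M : fin_res 0 M -> exists P (e : Hom P M),
  [/\ X P, rel_epi X e, rel_mono X e & is_zero_ob M -> is_zero_ob P].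
Proof.
have [M0 _|nM0] := pselect (is_zero_ob M).
  exists M, (idm M); split=> //; first exact: sub_zero.
    exact: rel_epi1.
  by move=> X0 _ h; rewrite comp1m.
by case=> P [e [XP eE eM]]; exists P, e.
Qed.

Lemma fin_resS_normal r M : fin_res r.+1 M -> exists P (e : Hom P M) K (k : Hom K P),
  [/\ X P, rel_epi X e, is_kernel e k, fin_res r K
    & is_zero_ob M -> is_zero_ob P /\ is_zero_ob K].
Proof.
have [M0 _|nM0] := pselect (is_zero_ob M).
  exists M, (idm M), M, (idm M); split=> //.
  - exact: sub_zero.
  - exact: rel_epi1.
  - split=> [|T t _]; first exact: zero_ob_to.
    by exists t; split=> [|u <-]; rewrite comp1m.
  - exact: fin_res_zero.
by case=> P [e [K [k [XP eE kk rK]]]]; exists P, e, K, k.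
Qed.

End FiniteResolutions.

(** * Resolving bounded complexes *)

Section Resolving.
Variables (A : AbCat) (X : Subcat A).
Implicit Types C D : Complex A.

(** [f] induces isomorphisms on the cohomology of [Hom(X0, -)] for [X0] in [X],
    written as the exactness of [Hom(X0, -)] on its mapping cone. *)
Definition rel_qis D C (f : ChainMap D C) : Prop :=
  forall i j l (ij : i + 1 = j) (jl : j + 1 = l) X0, X X0 ->
  forall (x : Hom X0 (D l)) (y : Hom X0 (C j)),
    diff D l \c x = 0 -> f l \c x = dd C jl \c y ->
  exists (x' : Hom X0 (D j)) (y' : Hom X0 (C i)),
    dd D jl \c x' = x /\ f j \c x' + dd C ij \c y' = y.

Lemma rel_qisE D C (f : ChainMap D C) :
  (forall n X0, X X0 -> forall (x : Hom X0 (D (n + 1))) (y : Hom X0 (C n)),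
    diff D (n + 1) \c x = 0 -> f (n + 1) \c x = diff C n \c y ->
    exists x', diff D n \c x' = x /\ f n \c x' = y) ->
  rel_qis f.
Proof.
move=> fP i j l ij jl X0 XX0.
case: _ / jl => x y dx fx; have [x' [x'P y'P]] := fP j X0 XX0 x y dx fx.
by exists x', 0; rewrite compm0 addr0.
Qed.

Lemma rel_qis_comp E D C (f : ChainMap D C) (g : ChainMap E D) :
  rel_qis f -> rel_qis g -> rel_qis (chain_comp f g).
Proof.
move=> fQ gQ i j l ij jl X0 XX0 x y dx /=; rewrite -compmA => fgx.
have [|x1 [y1 [dx1 x1y1]]] := fQ i j l ij jl X0 XX0 (g l \c x) y _ fgx.
  by rewrite compmA chainP -compmA dx compm0.
have [|x2 [y2 [dx2 x2y2]]] := gQ i j l ij jl X0 XX0 x x1 dx; first by rewrite dx1.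
exists x2, (f i \c y2 + y1); split=> //.
by rewrite compmDr compmA dd_chain addrA -!compmA -compmDr x2y2.
Qed.

(** When every [C n] has a map [P n -> C n] bijective under [Hom(X0, -)], the
    differential of [C] lifts uniquely to one on the objects [P n]. *)
Lemma resolve0 (C : BComplex A) : (forall n, fin_res X 0 (C n)) ->
  exists (D : BComplex A) (f : ChainMap D C), (forall n, X (D n)) /\ rel_qis f.
Proof.
move=> rC.
pose hP n := cid (fin_res0_normal (rC n)); pose P n := sval (hP n).
pose he n := cid (svalP (hP n)); pose e n : Hom (P n) (C n) := sval (he n).
have eP n : [/\ X (P n), rel_epi X (e n), rel_mono X (e n)
  & is_zero_ob (C n) -> is_zero_ob (P n)] := svalP (he n).
have lift n : exists d : Hom (P n) (P (n + 1)), e (n + 1) \c d = diff C n \c e n.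
  by have [XP _ _ _] := eP n; have [_ eE _ _] := eP (n + 1); apply: eE.
pose d n := sval (cid (lift n)); have dP n := svalP (cid (lift n)).
have d2 n : d (n + 1) \c d n = 0.
  have [XP _ _ _] := eP n; have [_ _ eM _] := eP (n + 1 + 1).
  by apply: eM => //; rewrite compmA dP -compmA dP compmA diff2 comp0m.
pose D : Complex A := Build_Complex d2.
have bD : bounded D.
  by have [N bC] := bcomplexP C; exists N => n Nn; have [_ _ _] := eP n; apply; apply: bC.
pose f : ChainMap D C := @Build_ChainMap A D C e (fun n => esym (dP n)).
exists {| bcomplex := D; bcomplexP := bD |}, f; split=> [n|]; first by case: (eP n).
apply: rel_qisE => n X0 XX0 x y dx fx.
have [_ eE _ _] := eP n; have [_ _ eM _] := eP (n + 1).
have [q qP] := eE X0 XX0 y.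
exists q; split=> //=; apply/eqP; rewrite -subr_eq0; apply/eqP; apply: eM => //.
by rewrite compmB compmA dP -compmA qP fx subrr.
Qed.

(** The complex of the pullbacks [L n], with differential [(a, b) |-> (0, a)] for
    [a] in [P (n + 1)] and [b] in [P n]. *)
Lemma resolve_step r (C : BComplex A) : (forall n, fin_res X r.+1 (C n)) ->
  exists (D : BComplex A) (f : ChainMap D C), (forall n, fin_res X r (D n)) /\ rel_qis f.
Proof.
move=> rC.
pose hP n := cid (fin_resS_normal (rC n)); pose P n := sval (hP n).
pose he n := cid (svalP (hP n)); pose e n : Hom (P n) (C n) := sval (he n).
pose hK n := cid (svalP (he n)); pose K n := sval (hK n).
pose hk n := cid (svalP (hK n)); pose k n : Hom (K n) (P n) := sval (hk n).
have eP n : [/\ X (P n), rel_epi X (e n), is_kernel (e n) (k n), fin_res X r (K n)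
  & is_zero_ob (C n) -> is_zero_ob (P n) /\ is_zero_ob (K n)] := svalP (hk n).
have pullback n : exists (L : A) (a : Hom L (P (n + 1))) (b : Hom L (P n)),
  [/\ fin_res X r L,
      e (n + 1) \c a = diff C n \c e n \c b,
      forall T (u v : Hom T L), a \c u = a \c v -> b \c u = b \c v -> u = v,
      forall T (x : Hom T (P (n + 1))) (y : Hom T (P n)),
        e (n + 1) \c x = diff C n \c e n \c y -> exists z, a \c z = x /\ b \c z = y
    & is_zero_ob (C n) -> is_zero_ob (C (n + 1)) -> is_zero_ob L].
  have [XP _ _ _ zP] := eP n; have [_ eE kk rK zK] := eP (n + 1).
  have [h hP'] := eE _ XP (diff C n \c e n).
  have [L KPL] := ab_sum (K (n + 1)) (P n).
  have rL := fin_res_sum KPL rK XP.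
  case: KPL => [i1 [i2 [p1 [p2 [pi1 pi2 pi12 pi21 ip]]]]].
  exists L, (k (n + 1) \c p1 + h \c p2), p2; split=> //.
  - by rewrite compmDr !compmA (kernel_comp0 kk) comp0m add0r hP'.
  - move=> T u v; rewrite !compmDl -!compmA => + uv; rewrite uv => /addIr.
    move/(kernel_mono kk) => p1uv.
    by rewrite -(comp1m u) -(comp1m v) -ip !compmDl -!compmA uv p1uv.
  - move=> T x y xy; have [|z zP'] := kernel_lift (t := x - h \c y) kk.
      by rewrite compmB compmA hP' xy subrr.
    exists (i1 \c z + i2 \c y); rewrite !compmDl !compmDr -!compmA !(compmA p1) !(compmA p2).
    rewrite pi1 pi12 pi21 pi2 !comp0m !comp1m !compm0 add0r addr0 zP'.
    by rewrite add0r subrK.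
  - move=> /zP [P0 _] /zK [_ K0]; apply: is_zero_obP; rewrite -ip.
    by rewrite (zero_ob_from i1 K0) (zero_ob_from i2 P0) !comp0m addr0.
pose hL n := cid (pullback n); pose L n := sval (hL n).
pose ha n := cid (svalP (hL n)); pose a n : Hom (L n) (P (n + 1)) := sval (ha n).
pose hb n := cid (svalP (ha n)); pose b n : Hom (L n) (P n) := sval (hb n).
have LP n : [/\ fin_res X r (L n),
      e (n + 1) \c a n = diff C n \c e n \c b n,
      forall T (u v : Hom T (L n)), a n \c u = a n \c v -> b n \c u = b n \c v -> u = v,
      forall T (x : Hom T (P (n + 1))) (y : Hom T (P n)),
        e (n + 1) \c x = diff C n \c e n \c y ->
        exists z, a n \c z = x /\ b n \c z = y
    & is_zero_ob (C n) -> is_zero_ob (C (n + 1)) -> is_zero_ob (L n)] := svalP (hb n).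
have exd n : exists d : Hom (L n) (L (n + 1)), a (n + 1) \c d = 0 /\ b (n + 1) \c d = a n.
  have [_ ea _ _ _] := LP n; have [_ _ _ pb _] := LP (n + 1); apply: pb.
  by rewrite compm0 -compmA ea !compmA diff2 !comp0m.
pose d n := sval (cid (exd n)).
have ad n : a (n + 1) \c d n = 0 by case: (svalP (cid (exd n))).
have bd n : b (n + 1) \c d n = a n by case: (svalP (cid (exd n))).
have d2 n : d (n + 1) \c d n = 0.
  have [_ _ ab _ _] := LP (n + 1 + 1).
  by apply: ab; rewrite !compmA ?ad ?bd ?ad ?comp0m compm0.
pose D : Complex A := Build_Complex d2.
have bD : bounded D.
  have [N bC] := bcomplexP C; exists N.+1 => n Nn.
  by have [_ _ _ _] := LP n; apply; apply: bC; lia.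
have fP n : diff C n \c (e n \c b n) = (e (n + 1) \c b (n + 1)) \c diff D n.
  by have [_ ea _ _ _] := LP n; rewrite /= -compmA bd ea compmA.
pose f : ChainMap D C := @Build_ChainMap A D C (fun n => e n \c b n) fP.
exists {| bcomplex := D; bcomplexP := bD |}, f; split=> [n|]; first by case: (LP n).
apply: rel_qisE => n X0 XX0 x y /= dx fx.
have [_ eE _ _ _] := eP n; have [_ _ _ pb _] := LP n; have [_ _ ab _ _] := LP (n + 1).
have [q qP] := eE X0 XX0 y.
have [|z [az bz]] := pb X0 (b (n + 1) \c x) q; first by rewrite -compmA qP compmA.
exists z; split; last by rewrite -compmA bz.
apply: ab; last by rewrite compmA bd.
by rewrite compmA ad comp0m -bd -compmA dx compm0.
Qed.

Lemma resolve r (C : BComplex A) : (forall n, fin_res X r (C n)) ->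
  exists (D : BComplex A) (f : ChainMap D C), (forall n, X (D n)) /\ rel_qis f.
Proof.
elim: r C => [|r IHr] C; first exact: resolve0.
move=> /resolve_step [D [f [/IHr [E [g [XE gQ]]] fQ]]].
by exists E, (chain_comp f g); split=> //; apply: rel_qis_comp.
Qed.

End Resolving.

(** * Coresolving bounded complexes *)

Section Coresolving.
Variables (A : AbCat) (Y : Subcat A).

(** The dual of [rel_qis]: exactness of [Hom(-, Y0)] on the mapping cone of [f]. *)
Definition rel_coqis (D C : Complex A) (f : ChainMap D C) : Prop :=
  forall i j l (ij : i + 1 = j) (jl : j + 1 = l) Y0, Y Y0 ->
  forall (x : Hom (D j) Y0) (y : Hom (C i) Y0),
    (forall m (mi : m + 1 = i), y \c dd C mi = 0) -> y \c f i = x \c dd D ij ->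
  exists (x' : Hom (D l) Y0) (y' : Hom (C j) Y0),
    y' \c dd C ij = y /\ y' \c f j + x' \c dd D jl = x.

Section OppositeMap.
Variables (D : Complex A) (E : Complex (op_preadd A)) (f : ChainMap E (op_complex D)).

(** The component of [f] in degree [i], read off in the degree [m] equal to [- i] of [D]. *)
Definition unop_comp (i m : int) (e : - i = m) : @Hom A (D m) (E i) :=
  match e in _ = m return @Hom A (D m) (E i) with erefl => f i end.

Lemma unop_comp_dd i j m n (ij : i + 1 = j) (jm : - j = m) (i_n : - i = n)
    (mn : m + 1 = n) :
  @compm A _ _ _ (dd E ij) (unop_comp jm) = unop_comp i_n \c dd D mn.
Proof.
case: _ / jm mn => mn; case: _ / i_n mn => mn.
have := dd_chain f ij; rewrite (dd_op D _ mn) => eq; exact: (esym eq).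
Qed.

Definition unop_chain : ChainMap D (unop_complex E).
Proof.
refine (@Build_ChainMap A D (unop_complex E)
          (fun n => unop_comp (opprK n)) _) => n.
exact: (unop_comp_dd (opp_succ (erefl (n + 1))) (opprK n) (opprK (n + 1))
          (erefl (n + 1))).
Defined.

Lemma unop_qis : @rel_qis (op_ab A) (op_sub Y) E (op_complex D) f ->
  rel_coqis unop_chain.
Proof.
move=> fQ.
have gen i j l (ij : i + 1 = j) (jl : j + 1 = l) i' j' l'
    (lm : - l = l') (jm : - j = j') (im : - i = i') (lj : l' + 1 = j') (ji : j' + 1 = i')
    Y0 (x : Hom (D j') Y0) (y : @Hom A (E l) Y0) : Y Y0 ->
    (forall m (lm : l + 1 = - m), @compm A _ _ _ y (dd E lm) = 0) ->
    y \c unop_comp lm = x \c dd D lj ->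
    exists (x' : Hom (D i') Y0) (y' : @Hom A (E j) Y0),
      @compm A _ _ _ y' (dd E jl) = y /\ y' \c unop_comp jm + x' \c dd D ji = x.
  case: _ / lm lj => lj; case: _ / jm lj ji x => lj ji x.
  case: _ / im ji => ji YY0 dy fy.
  have {}dy : @compm A _ _ _ y (diff E l) = 0.
    by have := dy (- (l + 1)); rewrite opprK => /(_ erefl).
  have := fQ i j l ij jl Y0 YY0 y x dy; rewrite (dd_op D jl lj) (dd_op D ij ji).
  by case=> [|y' [x' [y'P x'P]]] //; exists x', y'.
move=> i j l ij jl Y0 YY0 x y dy fy.
rewrite (dd_unop E ij (opp_succ ij)).
apply: (gen (- l) (- j) (- i) (opp_succ jl) (opp_succ ij) l j i
          (opprK i) (opprK j) (opprK l) ij jl) => //.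
move=> m im; have := dy m (oppr_succ im).
by rewrite (dd_unop E _ im).
Qed.

End OppositeMap.

Lemma coresolve r (C : BComplex A) :
  (forall n, @fin_res (op_ab A) (op_sub Y) r (C n)) ->
  exists (D : BComplex A) (f : ChainMap C D), (forall n, Y (D n)) /\ rel_coqis f.
Proof.
move=> rC.
have bC : @bounded (op_ab A) (op_complex C).
  have [N bC] := bcomplexP C; exists N => n Nn.
  by apply/op_is_zero/bC; rewrite abszN.
have [|E [f [YE fQ]]] := @resolve (op_ab A) (op_sub Y) r
  {| bcomplex := op_complex C : Complex (op_ab A); bcomplexP := bC |}.
  by move=> n; apply: rC.
have bE : bounded (unop_complex E).
  have [N bE] := bcomplexP E; exists N => n Nn.
  by apply/is_zero_op/bE; rewrite abszN.
exists {| bcomplex := unop_complex E; bcomplexP := bE |}, (unop_chain f).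
by split=> [n|]; [apply: YE | apply: unop_qis].
Qed.

End Coresolving.

(** * Mapping cones *)

Section Cones.
Variables (A : AbCat) (X Y : Subcat A) (D C : BComplex A) (f : ChainMap D C).

Lemma cone_exists : exists (Z : BComplex A) (g : ChainMap C Z)
  (h : ChainMap Z (shift_complex D)), standard_triangle f g h.
Proof.
pose hZ n := cid (ab_sum (D (n + 1)) (C n)); pose Z n := sval (hZ n).
pose hi n := cid (svalP (hZ n)); pose i n : Hom (D (n + 1)) (Z n) := sval (hi n).
pose hg n := cid (svalP (hi n)); pose g n : Hom (C n) (Z n) := sval (hg n).
pose hh n := cid (svalP (hg n)); pose h n : Hom (Z n) (D (n + 1)) := sval (hh n).
pose hq n := cid (svalP (hh n)); pose q n : Hom (Z n) (C n) := sval (hq n).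
have bi n : is_biproduct (i n) (g n) (h n) (q n) := svalP (hq n).
pose d n := - (i (n + 1) \c diff D (n + 1) \c h n) + g (n + 1) \c f (n + 1) \c h n
            + g (n + 1) \c diff C n \c q n.
have hd n : h (n + 1) \c d n = - (diff D (n + 1) \c h n).
  have [hi' qg hg' qi ig] := bi (n + 1).
  by rewrite /d !compmDr compmN !compmA hi' hg' !comp0m comp1m !addr0.
have qd n : q (n + 1) \c d n = f (n + 1) \c h n + diff C n \c q n.
  have [hi' qg hg' qi ig] := bi (n + 1).
  by rewrite /d !compmDr compmN !compmA qi qg !comp0m !comp1m oppr0 add0r.
have d2 n : d (n + 1) \c d n = 0.
  rewrite [d (n + 1)]/d !compmDl compNm -!compmA hd qd !compmN !compmDr.
  rewrite !(compmA (diff _ _)) !diff2 !comp0m !compm0 !oppr0 add0r addr0.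
  by rewrite chainP -!compmA addNr.
pose ZZ : Complex A := Build_Complex d2.
have bZ : bounded ZZ.
  have [N bD] := bcomplexP D; have [M bC] := bcomplexP C.
  exists (N + M).+1 => n nn.
  apply: is_zero_obP; have [_ _ _ _ <-] := bi n.
  have D0 : is_zero_ob (D (n + 1)) by apply: bD; lia.
  have C0 : is_zero_ob (C n) by apply: bC; lia.
  by rewrite (zero_ob_from (i n) D0) (zero_ob_from (g n) C0) !comp0m addr0.
have gP n : diff ZZ n \c g n = g (n + 1) \c diff C n.
  have [hi' qg hg' qi ig] := bi n.
  by rewrite /= /d !compmDl compNm -!compmA hg' qg !compm0 oppr0 !add0r compm1.
have hP n : diff (shift_complex D) n \c h n = h (n + 1) \c diff ZZ n.
  by rewrite /= hd compNm.
exists {| bcomplex := ZZ; bcomplexP := bZ |}, (Build_ChainMap gP).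
by exists (@Build_ChainMap A ZZ (shift_complex D) h hP), i, q => n; split.
Qed.

Variables (Z : BComplex A) (g : ChainMap C Z) (h : ChainMap Z (shift_complex D)).
Hypothesis std : standard_triangle f g h.

Lemma right_acyclic_cone : rel_qis X f -> right_acyclic X Z.
Proof.
case: std => i [q dZ] fQ X0 XX0 n u du.
have hd m : h (m + 1) \c diff Z m = - (diff D (m + 1) \c h m).
  by rewrite -chainP /= compNm.
have qd m : q (m + 1) \c diff Z m = f (m + 1) \c h m + diff C m \c q m.
  have [_ ->] := dZ m; have [[_ qg _ qi _] _] := dZ (m + 1).
  by rewrite !compmDr compmN !compmA qi qg !comp0m !comp1m oppr0 add0r.
have dx : diff D (n + 1 + 1) \c (h (n + 1) \c u) = 0.
  by apply: oppr_inj; rewrite compmA -compNm -hd -compmA du compm0 oppr0.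
have fx : f (n + 1 + 1) \c (h (n + 1) \c u) = diff C (n + 1) \c - (q (n + 1) \c u).
  apply/eqP; rewrite compmN -addr_eq0 !compmA -compmDl -qd -compmA du compm0.
  exact: eqxx.
have [x [y [dx' xy]]] := fQ n _ _ erefl erefl X0 XX0 _ _ dx fx.
have [[hi qg hg qi _] _] := dZ n; have [[_ _ _ _ ig] _] := dZ (n + 1).
pose v := - (i n \c x + g n \c y).
have hv : h n \c v = - x.
  by rewrite compmN compmDr !compmA hi hg comp0m comp1m addr0.
have qv : q n \c v = - y.
  by rewrite compmN compmDr !compmA qi qg comp0m comp1m add0r.
exists v; rewrite -[RHS]comp1m -[LHS]comp1m -ig !compmDl -!compmA.
rewrite !(compmA _ (diff Z n)) hd qd compmDl compNm -!compmA hv qv !compmN.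
by rewrite [diff _ _ \c x]dx' opprK -opprD xy opprK.
Qed.

Lemma left_acyclic_cone : rel_coqis Y f -> left_acyclic Y Z.
Proof.
case: std => i [q dZ] fQ Y0 YY0 n u du.
have di m : diff Z m \c i m = - (i (m + 1) \c diff D (m + 1)) + g (m + 1) \c f (m + 1).
  have [[hi qg hg qi _] ->] := dZ m.
  by rewrite !compmDl compNm -!compmA hi qi !compm0 !compm1 addr0.
have dg m : diff Z m \c g m = g (m + 1) \c diff C m by rewrite chainP.
have dy m (e : m + 1 = n + 1) : u \c g (n + 1) \c dd C e = 0.
  have mn : m = n by apply: addIr e.
  by subst m; rewrite ddE -compmA -dg compmA du comp0m.
have yf : u \c g (n + 1) \c f (n + 1) = u \c i (n + 1) \c diff D (n + 1).
  apply: (addrI (- (u \c i (n + 1) \c diff D (n + 1)))).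
  by rewrite addNr -!compmA -compmN -compmDr -di compmA du comp0m.
have [x [y [dy' xy]]] := fQ _ _ _ erefl erefl Y0 YY0 _ _ dy yf.
have [[_ _ _ _ ig] _] := dZ (n + 1).
have [[hi qg hg qi _] _] := dZ (n + 1 + 1).
pose v := y \c q (n + 1 + 1) - x \c h (n + 1 + 1).
have vi : v \c i (n + 1 + 1) = - x.
  by rewrite compBm -!compmA hi qi compm0 compm1 sub0r.
have vg : v \c g (n + 1 + 1) = y.
  by rewrite compBm -!compmA hg qg compm0 compm1 subr0.
have vdi : v \c diff Z (n + 1) \c i (n + 1) = u \c i (n + 1).
  rewrite -compmA di compmDr compmN !compmA vi vg !compNm opprK.
  by rewrite -[RHS]xy [RHS]addrC.
have vdg : v \c diff Z (n + 1) \c g (n + 1) = u \c g (n + 1).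
  by rewrite -compmA dg compmA vg dy'.
exists v; rewrite -[RHS]compm1 -[LHS]compm1 -ig.
by rewrite [in LHS]compmDr [in RHS]compmDr !compmA vdi vdg.
Qed.

End Cones.

(** * Triangles and localizations *)

Lemma iso_closure_refl (C : Category) (S : Functor C C) (B : triangles S)
  (U V W : C) (f : Mor U V) (g : Mor V W) (h : Mor W (S U)) :
  B U V W f g h -> iso_closure B f g h.
Proof.
move=> Bfgh; exists U, V, W, f, g, h.
exists (idc U), (idc U), (idc V), (idc V), (idc W), (idc W); split=> //.
have idP Z : inverse_pair (idc Z) (idc Z) by split; apply: comp1c.
have comm P Q (m : @Mor C P Q) : idc Q \C m =c m \C idc P.
  exact: Meq_trans (comp1c _) (Meq_sym (compc1 _)).
split; [by split | split=> //].
apply: Meq_trans (Meq_sym (compc1 _)).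
exact: Meq_trans (compc_proper (fmap1 _ _) (Meq_refl _)) (comp1c _).
Qed.

Lemma Loc_iso (C : Category) (W : forall U V : C, Mor U V -> Prop) (U V : C)
  (s : Mor U V) : W U V s -> @iso (Loc W) U V.
Proof.
move=> Ws; exists (loc_in W s), (loc_inv Ws).
by split; [apply: loceq_invl | apply: loceq_invr].
Qed.

(** A family of morphisms [O -> U], natural in [U], stays natural after
    localization. *)
Lemma Loc_natural (C : Category) (W : forall U V : C, Mor U V -> Prop) (O : C)
  (z : forall U, Mor O U) : (forall U V (f : Mor U V), f \C z U =c z V) ->
  forall U V (u : @Mor (Loc W) U V),
    u \C (loc_in W (z U) : @Mor (Loc W) O U) =c loc_in W (z V).
Proof.
move=> zP U V u; elim: u => {U V} [U V f|U V s Ws|U V T v IHv u IHu].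
- exact: loceq_trans (loceq_sym (loceq_in_comp W f (z U))) (loceq_in W (zP _ _ f)).
- have e := loceq_trans (loceq_sym (loceq_in_comp W s (z U))) (loceq_in W (zP _ _ s)).
  apply: loceq_trans (loceq_comp (loceq_refl _) (loceq_sym e)) _.
  apply: loceq_trans (loceq_assoc _ _ _) _.
  apply: loceq_trans (loceq_comp (loceq_invl Ws) (loceq_refl _)) _.
  exact: loceq_1l.
- apply: loceq_trans (loceq_sym (loceq_assoc _ _ _)) _.
  exact: loceq_trans (loceq_comp (loceq_refl _) IHu) IHv.
Qed.

Lemma zero_cat_of_natural_iso (C : Category) (O : C) (z : forall U, Mor O U) :
  (forall U V (f : Mor U V), f \C z U =c z V) ->
  (forall U, exists s : Mor U O, inverse_pair (z U) s) -> is_zero_cat C.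
Proof.
move=> zP zI; split; first by exists.
move=> U V; have [s [_ zs]] := zI U; exists (z V \C s) => g.
apply: Meq_trans (Meq_sym (compc1 g)) _.
apply: Meq_trans (compc_proper (Meq_refl g) (Meq_sym zs)) _.
apply: Meq_trans (compcA _ _ _) _.
exact: compc_proper (zP _ _ _) (Meq_refl _).
Qed.

Section SingularityCategories.
Variables (A : AbCat) (X Y : Subcat A) (XY : balanced_pair X Y).

Lemma Db_iso_of_cone (D C Z : BComplex A) (f : ChainMap D C) (g : ChainMap C Z)
  (h : ChainMap Z (shift_complex D)) :
  standard_triangle f g h -> star_acyclic X Y Z -> @iso (Db X Y) D C.
Proof.
move=> std sZ; apply: (@Loc_iso (Kb A) _ _ _ f).
by exists Z, g, h; split=> //; apply: iso_closure_refl.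
Qed.

Lemma iso_sym (T : Category) (U V : T) : iso U V -> iso V U.
Proof. by case=> u [v [vu uv]]; exists v, u. Qed.

Lemma Kb_image_of_fin_res r (C : BComplex A) :
  (forall n, fin_res X r (C n)) -> Kb_image X (C : Db X Y).
Proof.
move=> /resolve [D [f [XD fQ]]]; exists D; split=> //; apply: iso_sym.
have [Z [g [h std]]] := cone_exists f.
apply: (Db_iso_of_cone std); apply: (star_of_right XY).
by apply: right_acyclic_cone std fQ.
Qed.

Lemma Kb_image_of_fin_cores r (C : BComplex A) :
  (forall n, @fin_res (op_ab A) (op_sub Y) r (C n)) -> Kb_image Y (C : Db X Y).
Proof.
move=> /coresolve [D [f [YD fQ]]]; exists D; split=> //.
have [Z [g [h std]]] := cone_exists f.
apply: (Db_iso_of_cone std); apply: (star_of_left XY).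
by apply: left_acyclic_cone std fQ.
Qed.

Lemma op_has_resolution_of_length N n : has_coresolution_of_length Y N n ->
  @has_resolution_of_length (op_ab A) (op_sub Y) N n.
Proof.
case=> C [rC Cn]; exists (op_complex C); split; first exact: op_resolution.
by move=> i ni; apply/op_is_zero/Cn; lia.
Qed.

Lemma fin_cores_of_coresdim (S : A -> Prop) : sup_finite (coresdim Y) S ->
  exists r, forall M, S M -> @fin_res (op_ab A) (op_sub Y) r M.
Proof.
case=> N SN; exists N.+1 => M /SN [n]; rewrite /coresdim /least.
case: pselect => // exP [<-]; case: ex_minnP => m /asboolP Mm _ mN.
apply: (fin_res_le (r := m.+1)) => //.
by apply/fin_res_of_length/op_has_resolution_of_length.
Qed.

Lemma Kb_image_iso (P : Subcat A) (Z Z' : Db X Y) :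
  iso Z Z' -> Kb_image P Z' -> Kb_image P Z.
Proof.
case=> u [v [vu uv]] [C [PC [u' [v' [vu' uv']]]]]; exists C; split=> //.
exists (u' \C u), (v \C v'); split.
  apply: Meq_trans vu; apply: Meq_trans (Meq_sym (compcA _ _ _)) _.
  apply: compc_proper (Meq_refl _) _; apply: Meq_trans (compcA _ _ _) _.
  exact: Meq_trans (compc_proper vu' (Meq_refl _)) (comp1c _).
apply: Meq_trans uv'; apply: Meq_trans (Meq_sym (compcA _ _ _)) _.
apply: compc_proper (Meq_refl _) _; apply: Meq_trans (compcA _ _ _) _.
exact: Meq_trans (compc_proper uv (Meq_refl _)) (comp1c _).
Qed.

Lemma stable_class_eq (T : TriCat) (K K' : StableClass T) :
  (forall Z, K Z <-> K' Z) -> K = K'.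
Proof.
case: K K' => [K KS] [K' KS'] /= KK'.
have eqK : K = K' by apply/funext => Z; apply/propext.
by case: _ / eqK in KS' *; congr Build_StableClass; apply: Prop_irrelevance.
Qed.

(** Every map [0 -> Z] of the quotient is invertible: it is part of the triangle
    [0 -> Z -> Z -> 0], whose third object [Z] lies in the class. *)
Lemma zero_quotient (P : Subcat A) : (forall Z : Db X Y, Kb_image P Z) ->
  is_zero_cat (Verdier_quotient (Kb_sub X Y P)).
Proof.
move=> allP; have [O O0] := ab_zero A.
have od2 (n : int) : (0 : Hom O O) \c (0 : Hom O O) = 0 by rewrite compm0.
pose OC : Complex A := @Build_Complex A (fun=> O) (fun=> 0) od2.
have bO : bounded OC by exists 0%N.
pose OB : BComplex A := {| bcomplex := OC; bcomplexP := bO |}.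
have zc (C : BComplex A) n :
  diff C n \c (0 : Hom O (C n)) = (0 : Hom O (C (n + 1))) \c diff OC n.
  by rewrite compm0 comp0m.
pose z (C : Kb A) : @Mor (Kb A) OB C := @Build_ChainMap A OC C (fun=> 0) (@zc C).
have zP (U V : Kb A) (f : Mor U V) : f \C z U =c z V.
  by apply: chain_eq_homotopic => n /=; rewrite compm0.
pose z1 (C : Db X Y) : @Mor (Db X Y) (OB : Db X Y) C := fmap (Vfunctor _) (z C).
have z1P : forall (U V : Db X Y) (f : Mor U V), f \C z1 U =c z1 V by apply: Loc_natural.
pose z2 (C : Vcat (Kb_sub X Y P)) : @Mor (Vcat (Kb_sub X Y P)) OB C :=
  fmap (Vfunctor (Kb_sub X Y P)) (z1 C).
apply: (@zero_cat_of_natural_iso (Vcat (Kb_sub X Y P)) OB z2).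
  exact: Loc_natural.
move=> C.
have Ws : cone_in (Kb_sub X Y P) (z1 C).
  have ho n : diff (shift_complex OC) n \c (0 : Hom ((C : BComplex A) n) O)
    = 0 \c diff (C : BComplex A) n.
    by rewrite compm0 comp0m.
  pose h : @Mor (Kb A) C (transl (OB : Kb A)) :=
    @Build_ChainMap A (C : BComplex A) (shift_complex OC) (fun=> 0) ho.
  exists C, (fmap (Vfunctor _) (idc (C : Kb A))), (fmap (Vfunctor _) h);
    split; last exact: allP.
  apply: iso_closure_refl; exists (z C), (idc (C : Kb A)), h.
  split; last by split; apply: Meq_refl.
  apply: iso_closure_refl; exists (fun=> 0), (fun n => idm ((C : BComplex A) n)) => n /=.
  split; last by rewrite !(compm0, comp1m, compm1) oppr0 !add0r.
  split; rewrite ?(compm0, comp0m, comp1m, add0r) //; exact: (esym (zero_ob_to _ O0)).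
by exists (loc_inv Ws); split; [apply: loceq_invl | apply: loceq_invr].
Qed.


End SingularityCategories.

(** * Cosyzygies in an admissible balanced pair *)

Section Admissible.
Variables (A : AbCat) (X Y : Subcat A) (XY : balanced_pair X Y).
Hypothesis admX : admissible X.

Lemma rel_epi_is_epi (P M : A) (e : Hom P M) : X P -> rel_epi X e -> is_epi e.
Proof. by move=> XP eE; apply: admX; split=> // X1 g XX1; apply: eE. Qed.

Lemma mono_kernel_coker (U V Q : A) (i : Hom U V) (q : Hom V Q) :
  is_mono i -> is_cokernel i q -> is_kernel q i.
Proof.
move=> iM [qi qP]; have [W [g gi]] := ab_mono iM.
have [g' [gP _]] := qP _ g (kernel_comp0 gi).
split=> // T t qt; case: (gi) => _; apply.
by rewrite -gP -compmA qt compm0.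
Qed.

Section LeftApproximation.
Variables (Z Y0 Q : A) (i : Hom Z Y0) (q : Hom Y0 Q).
Hypotheses (iA : left_approx Y i) (qi : is_cokernel i q).

Let op_epi : @rel_epi (op_ab A) (op_sub Y) Y0 Z i.
Proof. by case: iA => _ iE Y1 YY1 g; apply: iE. Qed.

Lemma left_approx_cancel X0 (u : Hom X0 Z) : X X0 -> i \c u = 0 -> u = 0.
Proof.
move=> XX0.
exact: (@rel_epi_cancel (op_ab A) (op_sub Y) (op_sub X) (op_balanced_res XY)
          Y0 Z i op_epi X0 XX0 u).
Qed.

Lemma left_approx_lift X0 (u : Hom X0 Q) : X X0 -> exists h, q \c h = u.
Proof.
move=> XX0.
exact: (@rel_epi_extend (op_ab A) (op_sub Y) (op_sub X) (op_balanced_res XY)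
          Q Y0 Z q i qi op_epi X0 XX0 u).
Qed.

Lemma left_approx_mono : is_mono i.
Proof.
move=> T u v iuv; apply/eqP; rewrite -subr_eq0; apply/eqP.
have [P [e [XP eE]]] := bp_contra XY T.
have eP : is_epi e by apply: admX; split.
apply: eP; rewrite comp0m; apply: left_approx_cancel => //.
by rewrite compmA compmB iuv subrr comp0m.
Qed.

End LeftApproximation.

(** [Z] is the [r]-th cosyzygy of some object. *)
Fixpoint cosyzygy (r : nat) (Z : A) : Prop :=
  if r is r'.+1 then
    exists Z' Y0 (i : Hom Z' Y0) (q : Hom Y0 Z),
      [/\ left_approx Y i, is_cokernel i q & cosyzygy r' Z']
  else True.

(** The relative [Ext^1(L, Z)] vanishes if [Z] is an [r]-th cosyzygy of some [M] and
    [L] has an [X]-resolution of length [r]: it is [Ext^(r + 1)(L, M)].  The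
    induction passes to the syzygy of [L] and to the previous cosyzygy. *)
Lemma lift_cosyzygy r Z Y0 Q (i : Hom Z Y0) (q : Hom Y0 Q) L (f : Hom L Q) :
  cosyzygy r Z -> left_approx Y i -> is_cokernel i q -> fin_res X r L ->
  exists h, q \c h = f.
Proof.
elim: r Z Y0 Q i q L f => [|r IHr] Z Y0 Q i q L f rZ iA qi.
  case=> P [e [XP eE eM]]; have eP := rel_epi_is_epi XP eE.
  have [s sP] := left_approx_lift iA qi (f \c e) XP.
  have [K [k kk]] := ab_ker e.
  have [YY0 _] := iA.
  have [|h hP] := rel_epi_desc (bp_res XY) kk eE YY0 (u := s).
    have -> : k = 0; last by rewrite compm0.
    have [R [r [XR rE]]] := bp_contra XY K.
    apply: (rel_epi_is_epi XR (e := r)) => [X1 XX1 g|]; first exact: rE.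
    rewrite comp0m; apply: eM => //.
    by rewrite compmA (kernel_comp0 kk) comp0m.
  by exists h; apply: eP; rewrite -compmA hP sP.
case=> P [e [K [k [XP eE kk rK]]]]; have eP := rel_epi_is_epi XP eE.
have [Z' [Y1 [i' [q' [iA' qi' rZ']]]]] := rZ.
have [s sP] := left_approx_lift iA qi (f \c e) XP.
have [|t tP] := kernel_lift (t := s \c k) (mono_kernel_coker (left_approx_mono iA) qi).
  by rewrite compmA sP -compmA (kernel_comp0 kk) compm0.
have [t' t'P] := IHr _ _ _ i' q' K t rZ' iA' qi' rK.
have [YY1 _] := iA'; have [YY0 _] := iA.
have [w wP] := rel_epi_extend (bp_res XY) kk eE YY1 t'.
have [|h hP] := rel_epi_desc (bp_res XY) kk eE YY0 (u := s - i \c q' \c w).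
  by rewrite compBm -!compmA wP t'P tP subrr.
exists h; apply: eP; rewrite -compmA hP compmB !compmA sP.
by case: qi => -> _; rewrite !comp0m subr0.
Qed.

(** When all objects have [X]-resolutions of length [r], the [r]-th cosyzygies lie
    in [Y]. *)
Lemma fin_cores_of_fin_res r : (forall M, fin_res X r M) ->
  forall M, @fin_res (op_ab A) (op_sub Y) r M.
Proof.
move=> rX; have main s : forall m Z, (s + m = r)%N -> cosyzygy m Z ->
  @fin_res (op_ab A) (op_sub Y) s Z.
  elim: s => [|s IHs] m Z smr mZ;
    have [Y0 [i iA]] := bp_cov XY Z; have [Q [q qi]] := ab_coker i.
    move: (mZ); rewrite -[m]add0n smr => rZ.
    have [h hP] := lift_cosyzygy (idm Q) rZ iA qi (rX Q).
    (* The section [h] of [q] splits [Z -> Y0 -> Q]. *)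
    have iM := left_approx_mono iA; have qiK := mono_kernel_coker iM qi.
    have qi0 := kernel_comp0 qiK.
    have [|p pP] := kernel_lift (t := idm Y0 - h \c q) qiK.
      by rewrite compmB compmA hP comp1m compm1 subrr.
    have YZ : Y Z.
      case: iA => YY0 _; apply: sub_summand YY0; exists i, h, p, q; split=> //.
      - by apply: iM; rewrite compmA pP compBm comp1m -compmA qi0 compm0 subr0 compm1.
      - apply: (mono0 iM).
        by rewrite compmA pP compBm comp1m -compmA hP compm1 subrr.
      - by rewrite pP subrK.
    exists Z, (idm Z : @Hom (op_ab A) Z Z); split=> //; first exact: rel_epi1.
    by move=> Y1 _ u; rewrite comp1m.
  exists Y0, i, Q, q; split=> //.
  - by case: iA.
  - by case: iA => _ iE Y1 YY1 g; apply: iE.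
  - by apply: (IHs m.+1); [rewrite addnS -addSn | exists Z, Y0, i, q].
by move=> M; apply: (main r 0%N); rewrite ?addn0.
Qed.

End Admissible.

Theorem theorem4p13 (A : AbCat) (X Y : Subcat A) (XY : balanced_pair X Y) :
  (sup_finite (resdim X) Y -> sup_finite (coresdim Y) X ->
     D_RXsg X Y = D_LYsg X Y) /\
  (admissible X -> sup_finite (resdim X) (fun _ : A => True) ->
     is_zero_cat (D_RXsg X Y) /\ is_zero_cat (D_LYsg X Y)).
Proof.
split=> [/fin_res_of_resdim [r rY] /fin_cores_of_coresdim [s sX]|admX].
  rewrite /D_RXsg /D_LYsg; congr Verdier_quotient; apply: stable_class_eq => Z.
  split=> -[C [PC ZC]]; apply: Kb_image_iso ZC _.
    by apply: (Kb_image_of_fin_cores XY (r := s)) => n; apply: sX.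
  by apply: (Kb_image_of_fin_res XY (r := r)) => n; apply: rY.
move=> /fin_res_of_resdim [r rA].
have rX M : fin_res X r M by apply: rA.
split; apply: zero_quotient => Z;
  first exact: (Kb_image_of_fin_res XY (C := Z) (r := r)).
apply: (Kb_image_of_fin_cores XY (C := Z) (r := r)) => n.
exact: (fin_cores_of_fin_res XY admX).
Qed.
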